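(* Let $\gamma,\delta,m>0$ and $\underline{c}>-\infty$ be given. Then for all $M>0$ there exists a constant $L>0$, depending on $M,\gamma,\delta,m$, and $\underline{c}$, such that $$\|\mathcal{S}_\gamma(c_\mu,\mu_1,\mu_2)-\mathcal{S}_\gamma(c_\nu,\nu_1,\nu_2)\|_{L^2(\Omega)}\le L\,\|(c_\mu,\mu_1,\mu_2)-(c_\nu,\nu_1,\nu_2)\|_{\mathcal{H}(\Omega)}^{1/2}$$ for all $(c_\mu,\mu_1,\mu_2),(c_\nu,\nu_1,\nu_2)\in\mathcal{C}_{\underline{c}}(\Omega)\times\mathcal{M}_\delta^m(\Omega)$ with $$\|(c_\mu,\mu_1,\mu_2)\|_{\mathcal{H}(\Omega)}\le M,\qquad \|(c_\nu,\nu_1,\nu_2)\|_{\mathcal{H}(\Omega)}\le M.$$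
   Context: Domains (fixed): $d_1,d_2\in\mathbb{N}$; $\Omega_1\subset\mathbb{R}^{d_1}$ and $\Omega_2\subset\mathbb{R}^{d_2}$ are compact connected sets with non-empty interior; $\Omega:=\Omega_1\times\Omega_2$ coincides with the closure of its interior and has a Lipschitz boundary. $\lambda_i$ is the Lebesgue measure on $\Omega_i$ and $\lambda=\lambda_1\otimes\lambda_2$; $L^p$ spaces are with respect to Lebesgue measure. Sets: $$\mathcal{H}(\Omega):=L^2(\Omega)\times L^2(\Omega_1)\times L^2(\Omega_2)\ \text{(with the product norm)},$$ $$\mathcal{C}_{\underline{c}}(\Omega):=\{c\in L^2(\Omega)\colon c\ge\underline{c}\ \lambda\text{-a.e. in }\Omega\},$$ $$\mathcal{M}_\delta^m(\Omega):=\{(\mu_1,\mu_2)\in L^2(\Omega_1)\times L^2(\Omega_2)\colon \|\mu_1\|_{L^1(\Omega_1)}=\|\mu_2\|_{L^1(\Omega_2)}=m,\ \mu_i\ge\delta\ \lambda_i\text{-a.e. in }\Omega_i,\ i=1,2\}.$$ Solution operator: for $\gamma>0$, $c\in L^2(\Omega)$, and $\mu_i\in L^2(\Omega_i)$, $\mu_i\ge0$ a.e., $i=1,2$, with $\|\mu_1\|_{L^1(\Omega_1)}=\|\mu_2\|_{L^1(\Omega_2)}$, $\mathcal{S}_\gamma(c,\mu_1,\mu_2)\in L^2(\Omega)$ denotes the solution (known to exist and to be unique) of the quadratically regularized Kantorovich problem: minimize $\int_\Omega c\,\pi\,\mathrm{d}\lambda+\frac{\gamma}{2}\|\pi\|_{L^2(\Omega)}^2$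 over all $\pi\in L^2(\Omega)$ with $\pi\ge0$ $\lambda$-a.e., $\int_{\Omega_2}\pi(x_1,x_2)\,\mathrm{d}\lambda_2(x_2)=\mu_1(x_1)$ for $\lambda_1$-a.a. $x_1\in\Omega_1$, and $\int_{\Omega_1}\pi(x_1,x_2)\,\mathrm{d}\lambda_1(x_1)=\mu_2(x_2)$ for $\lambda_2$-a.a. $x_2\in\Omega_2$. *)

(* Defs.v *)
From HB Require Import structures.
From mathcomp Require Import all_boot all_order all_algebra.
From mathcomp Require Import all_classical all_reals all_analysis.
From mathcomp Require Import measurable_realfun.

Set Implicit Arguments.
Unset Strict Implicit.
Unset Printing Implicit Defensive.
Import Order.TTheory GRing.Theory Num.Theory.
Import numFieldNormedType.Exports.

Local Open Scope classical_set_scope.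
Local Open Scope ring_scope.

(* R^n is 'rV[R]_n, with the topology provided by the library and with the
   sigma-algebra generated by the coordinates, i.e., its Borel sigma-algebra
   (see [measurable_open_rV]). *)
Section measurable_rV.
Variables (R : realType) (n : nat).

Definition coord_rV : 'I_n -> 'rV[R]_n -> R := fun i x => x ord0 i.

Let rV_set0 : g_sigma_preimage coord_rV set0.
Proof. exact: sigma_algebra0. Qed.

Let rV_setC A : g_sigma_preimage coord_rV A -> g_sigma_preimage coord_rV (~` A).
Proof. exact: sigma_algebraC. Qed.

Let rV_bigcup (F : _^nat) : (forall i, g_sigma_preimage coord_rV (F i)) ->
  g_sigma_preimage coord_rV (\bigcup_i (F i)).
Proof. exact: sigma_algebra_bigcup. Qed.

HB.instance Definition _ :=
  @isMeasurable.Build (measure_tuple_display default_measure_display)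
    'rV[R]_n (g_sigma_preimage coord_rV) rV_set0 rV_setC rV_bigcup.

Lemma measurable_coord_rV (i : 'I_n) :
  measurable_fun [set: 'rV[R]_n] (fun x : 'rV[R]_n => x ord0 i).
Proof.
move=> _ Y mY; rewrite setTI; apply: sub_sigma_algebra => /=.
rewrite -bigcup_seq/=; exists i => /=; first by rewrite mem_index_enum.
by exists Y => //; rewrite setTI.
Qed.

Lemma measurable_fun_rV d (T : measurableType d) (f : T -> 'rV[R]_n) :
  (forall i, measurable_fun [set: T] (fun x => f x ord0 i)) ->
  measurable_fun [set: T] f.
Proof.
move=> mf.
suff : g_sigma_preimage (fun i => coord_rV i \o f) `<=` measurable.
  by rewrite g_sigma_preimage_comp => prefS _ A mA; apply: prefS; exists A.
apply: smallest_sub; first exact: sigma_algebra_measurable.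
by rewrite -bigcup_seq => A [i _ [B mB <-]]; exact: (mf i).
Qed.

Lemma measurable_ball_rV (x : 'rV[R]_n) (e : R) : measurable (ball x e).
Proof.
rewrite (_ : ball x e = (\bigcap_(i in [set: 'I_n])
    coord_rV i @^-1` (ball (x ord0 i) e)) `&` [set _ | 0 < e]).
  apply: measurableI.
    apply: fin_bigcap_measurable => // i _.
    rewrite -[X in measurable X]setTI; apply: measurable_coord_rV => //.
    exact: measurable_ball.
  by case: (ltP 0 e) => e0; [rewrite (_ : mkset _ = setT)|rewrite (_ : mkset _ = set0)];
    rewrite //; apply/seteqP; split.
apply/seteqP; split => y.
  by move=> [e0 xy]; split=> // i _; exact: xy.
by move=> [xy e0]; split=> // i j; rewrite (ord1 i); exact: xy.
Qed.

Lemma measurable_open_rV (A : set 'rV[R]_n) : open A -> measurable A.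
Proof.
move=> oA.
pose B (p : 'rV[rat]_n * nat) := ball (map_mx (@ratr R) p.1) p.2.+1%:R^-1.
rewrite (_ : A = \bigcup_(p in [set p | B p `<=` A]) B p).
  rewrite bigcup_mkcond; apply: countable_bigcupT_measurable => // p.
  by case: ifPn => // _; exact: measurable_ball_rV.
apply/seteqP; split => [x Ax|x [p /= + Bx]]; last exact.
have /nbhs_ballP[e /= e0 xeA] : nbhs x A by exact: open_nbhs_nbhs.
have [k ke] : exists k, k.+1%:R^-1 < e / 2.
  have e20 : 0 < e / 2 by rewrite divr_gt0.
  exists (Num.truncn (e / 2)^-1).
  by rewrite -[ltRHS]invrK ltf_pV2 ?posrE ?invr_gt0//; exact: truncnS_gt.
have k0 : (0 : R) < k.+1%:R^-1 by rewrite invr_gt0.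
have /choice[q xq] : forall i, exists q : rat,
    `|x ord0 i - ratr q| < k.+1%:R^-1.
  move=> i.
  have [q] := rat_in_itvoo (ltr_pwDr k0 (lexx (x ord0 i))).
  rewrite in_itv/= => /andP[xq qx].
  by exists q; rewrite distrC ger0_norm ?subr_ge0 ?ltW// ltrBlDl.
have Bx : B (\row_i q i, k) x.
  split=> // i j; rewrite (ord1 i) !mxE /ball/= distrC; exact: xq.
exists (\row_i q i, k) => //= y [_ By]; apply: xeA; split=> // i j.
have := By i j; rewrite !(ord1 i) !mxE /ball/= => qy.
rewrite -(subrKA (ratr (q j))) (le_lt_trans (ler_normD _ _))//.
by rewrite (splitr e) ltrD// (lt_trans _ ke).
Qed.

End measurable_rV.

Section lebesgue_rV.
Variable R : realType.

Definition cons_rV n (p : R * 'rV[R]_n) : 'rV[R]_n.+1 :=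
  \row_i if unlift ord0 i is Some j then p.2 ord0 j else p.1.

Definition uncons_rV n (x : 'rV[R]_n.+1) : R * 'rV[R]_n :=
  (x ord0 ord0, \row_j x ord0 (lift ord0 j)).

Lemma cons_rVK n : cancel (@cons_rV n) (@uncons_rV n).
Proof.
move=> [a x]; rewrite /uncons_rV /cons_rV mxE unlift_none; congr pair.
by apply/rowP => j; rewrite !mxE liftK.
Qed.

Lemma measurable_cons_rV n : measurable_fun setT (@cons_rV n).
Proof.
apply: measurable_fun_rV => i; under eq_fun do rewrite mxE.
case: (unliftP ord0 i) => [j _|_]; last exact: measurable_fst.
exact: (measurableT_comp (@measurable_coord_rV R n j) measurable_snd).
Qed.

Lemma measurable_uncons_rV n : measurable_fun setT (@uncons_rV n).
Proof.
apply/measurable_fun_pairP; split; first exact: measurable_coord_rV.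
apply: measurable_fun_rV => i /=; under eq_fun do rewrite mxE.
exact: measurable_coord_rV.
Qed.

Section lebesgue_cons.
Variables (n : nat) (m : {sigma_finite_measure set 'rV[R]_n -> \bar R}).

Definition lebesgue_cons : set 'rV[R]_n.+1 -> \bar R :=
  pushforward (@lebesgue_measure R \x m)%E (@cons_rV n).

Let push_cons : {measure set 'rV[R]_n.+1 -> \bar R} :=
  measure_function_pushforward__canonical__measure_function_Measure
    (@lebesgue_measure R \x m)%E (@measurable_cons_rV n).

HB.instance Definition _ := isMeasure.Build _ _ _ lebesgue_cons
  (measure0 push_cons) (measure_ge0 push_cons)
  (@measure_semi_sigma_additive _ _ _ push_cons).

Let lebesgue_cons_sigma_finite : sigma_finite setT lebesgue_cons.
Proof.
have /sigma_finiteP[F [FT ndF mF]] := sigma_finiteT (@lebesgue_measure R).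
have /sigma_finiteP[G [GT ndG mG]] := sigma_finiteT m.
exists (fun k => @uncons_rV n @^-1` (F k `*` G k)).
  rewrite -preimage_bigcup (_ : \bigcup_k _ = setT) ?preimage_setT//.
  apply/seteqP; split=> // -[x y] _.
  have [[k _ Fkx] [l _ Gly]] : (\bigcup_k F k) x /\ (\bigcup_k G k) y.
    by rewrite -FT -GT.
  exists (maxn k l) => //; split => /=.
    by move: x Fkx; exact/subsetPset/ndF/leq_maxl.
  by move: y Gly; exact/subsetPset/ndG/leq_maxr.
move=> k; have [mFk Fkoo] := mF k; have [mGk Gkoo] := mG k; split.
  rewrite -[X in measurable X]setTI; apply: measurable_uncons_rV => //.
  exact: measurableX.
rewrite /lebesgue_cons /pushforward -comp_preimage.
rewrite (_ : _ \o _ = id); last by apply/funext => p; exact: cons_rVK.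
by rewrite preimage_id product_measure1E// lte_mul_pinfty// ge0_fin_numE.
Qed.

HB.instance Definition _ := Measure_isSigmaFinite.Build _ _ _ lebesgue_cons
  lebesgue_cons_sigma_finite.

End lebesgue_cons.

Fixpoint lebesgue_rV n : {sigma_finite_measure set 'rV[R]_n -> \bar R} :=
  if n is n'.+1 then lebesgue_cons (lebesgue_rV n')
  else @dirac _ 'rV[R]_0 0 R.

Lemma lebesgue_rV_box n (F : 'I_n -> set R) : (forall i, measurable (F i)) ->
  lebesgue_rV n [set x | forall i, F i (x ord0 i)] =
  (\prod_(i < n) lebesgue_measure (F i))%E.
Proof.
elim: n F => [|n IHn] F mF.
  by rewrite big_ord0 /= diracE mem_set// => -[].
pose B := [set x : 'rV[R]_n | forall i, F (lift ord0 i) (x ord0 i)].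
have mB : measurable B.
  rewrite (_ : B = \bigcap_(i in [set: 'I_n])
      (fun x : 'rV[R]_n => x ord0 i) @^-1` F (lift ord0 i)).
    apply: fin_bigcap_measurable => // i _.
    by rewrite -[X in measurable X]setTI; exact: measurable_coord_rV.
  by apply/seteqP; split=> x /= Bx i; [move=> _|]; exact: Bx.
rewrite big_ord_recl -(IHn (fun i => F (lift ord0 i)))// -/B.
rewrite -product_measure1E//=; last exact: mF.
rewrite /lebesgue_cons /pushforward.
congr (product_measure1 _ _ _); apply/seteqP; split=> [[a x]/= Fx|[a x]/= [Fa Fx] i].
  split; first by have := Fx ord0; rewrite mxE unlift_none.
  by move=> i; have := Fx (lift ord0 i); rewrite mxE liftK.
by rewrite mxE; case: unliftP => [j ->|->].
Qed.

End lebesgue_rV.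

Section domain.
Variables (R : realType) (n : nat).
Implicit Types A : set 'rV[R]_n.

(* Near each boundary point p, and after a change of orthonormal coordinates
   x |-> (x - p) Q, the set A lies on one side of the graph of a Lipschitz
   function g giving the i-th coordinate in terms of the others. A Lipschitz
   function defined only near 0 extends to a global one, and the norm used in
   [k.-lipschitz] (the maximum norm) only affects the constant. *)
Definition lipschitz_boundary A := forall p, (closure A `\` A°) p ->
  exists (r k : R) (Q : 'M[R]_n) (i : 'I_n) (g : 'rV[R]_n.-1 -> R),
    [/\ 0 < r, Q *m Q^T = 1%:M, k.-lipschitz g &
        forall x, ball p r x ->
          let y := (x - p) *m Q in A x <-> g (col' i y) <= y ord0 i].

End domain.

(* A1 x A2 as a subset of R^(d1 + d2) *)
Definition prod_rV (R : realType) (d1 d2 : nat)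
    (A1 : set 'rV[R]_d1) (A2 : set 'rV[R]_d2) : set 'rV[R]_(d1 + d2) :=
  [set row_mx x.1 x.2 | x in A1 `*` A2].

Section L2.
Context d (T : measurableType d) (R : realType).
Variables (mu : {measure set T -> \bar R}) (D : set T).

(* Functions on D are represented by functions on the whole type whose values
   outside D are irrelevant: [f \_ D] is the extension by zero of f from D.
   Elements of L^2(D) are functions rather than classes of functions. *)
Definition L2 : set (T -> R) := [set f | (f \_ D) \in Lfun mu 2%:E].

Definition normL (p : \bar R) (f : T -> R) : \bar R :=
  'N[mu]_p[EFin \o (f \_ D)].

End L2.

Section transport.
Local Open Scope ereal_scope.
Variables (R : realType) (d1 d2 : nat).
Variables (Omega1 : set 'rV[R]_d1) (Omega2 : set 'rV[R]_d2).

Let lambda1 := lebesgue_rV R d1.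
Let lambda2 := lebesgue_rV R d2.
Let lambda := lambda1 \x lambda2.
Let Omega := Omega1 `*` Omega2.

Let T1 := 'rV[R]_d1.
Let T2 := 'rV[R]_d2.
Let T := (T1 * T2)%type.

Definition normH (c : T -> R) (mu1 : T1 -> R) (mu2 : T2 -> R) : \bar R :=
  (normL lambda Omega 2%:E c `^ 2 + normL lambda1 Omega1 2%:E mu1 `^ 2 +
   normL lambda2 Omega2 2%:E mu2 `^ 2) `^ 2^-1.

Definition costs (clow : R) : set (T -> R) :=
  [set c | L2 lambda Omega c /\
           {ae lambda, forall x, Omega x -> (clow <= c x)%R}].

Definition marginals (delta m : R) : set ((T1 -> R) * (T2 -> R)) :=
  [set mu |
    [/\ L2 lambda1 Omega1 mu.1, L2 lambda2 Omega2 mu.2,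
        normL lambda1 Omega1 1 mu.1 = m%:E /\
        normL lambda2 Omega2 1 mu.2 = m%:E,
        {ae lambda1, forall x, Omega1 x -> (delta <= mu.1 x)%R} &
        {ae lambda2, forall x, Omega2 x -> (delta <= mu.2 x)%R}]].

Definition plans (mu1 : T1 -> R) (mu2 : T2 -> R) : set (T -> R) :=
  [set p |
    [/\ L2 lambda Omega p,
        {ae lambda, forall x, Omega x -> (0 <= p x)%R},
        {ae lambda1, forall x1, Omega1 x1 ->
           \int[lambda2]_(x2 in Omega2) (p (x1, x2))%:E = (mu1 x1)%:E} &
        {ae lambda2, forall x2, Omega2 x2 ->
           \int[lambda1]_(x1 in Omega1) (p (x1, x2))%:E = (mu2 x2)%:E}]].

Definition objective (gamma : R) (c p : T -> R) : \bar R :=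
  \int[lambda]_(x in Omega) (c x * p x)%:E +
  (gamma / 2)%:E * normL lambda Omega 2%:E p `^ 2.

Definition is_optimal (gamma : R) (c : T -> R) (mu1 : T1 -> R) (mu2 : T2 -> R) :
    set (T -> R) := [set p |
  plans mu1 mu2 p /\
  forall q, plans mu1 mu2 q -> objective gamma c p <= objective gamma c q].

(* The solution is unique up to lambda-negligible sets; [get] selects one of
   its representatives. *)
Definition solution_op (gamma : R) (c : T -> R) (mu1 : T1 -> R) (mu2 : T2 -> R) :
    T -> R :=
  get (is_optimal gamma c mu1 mu2).

End transport.

(* Main.v *)
Require Import Defs.
From HB Require Import structures.
From mathcomp Require Import all_boot all_order all_algebra.
From mathcomp Require Import all_classical all_reals all_analysis.
From mathcomp Require Import measurable_realfun ring lra.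

(* The argument is primal and does not use Kantorovich potentials. Let s and s'
   be the minimizers for (c, mu) and (c', mu'), and let q = (s + s') / 2, which
   is a plan for the mean marginals. By strong convexity it suffices to repair q
   into plans for mu and for mu' at a cost of order t, the distance of the data.
   To repair q for mu, put u_i = min(1, mu_i / xi_i), where xi_i are the marginals
   of q, and damp q to p = (1 - t) u_1 u_2 q. Removing mass increases the cost at
   most by |clow| times the removed mass. The factor 1 - t makes the deficits
   r_i = mu_i - (i-th marginal of p) at least t mu_i, while ||r_i|| = O(t) since
   xi_i >= delta; hence the correction r_1 (x) r_2 / (mass of r_1), which restores
   the marginals, has norm O(t^2) / (t m) = O(t).
   Marginal constraints are used in weak form, <s, phi (x) 1> = <mu_1, phi> for
   all phi in L^2. *)

Set Implicit Arguments.
Unset Strict Implicit.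
Unset Printing Implicit Defensive.
Import Order.TTheory GRing.Theory Num.Theory.
Import numFieldNormedType.Exports.

Local Open Scope classical_set_scope.
Local Open Scope ring_scope.

(** * Square-integrable functions *)

(** The exponent 1/2 arises because each comparison with a repaired plan loses O(t), whereas strong
    convexity controls the square of the distance of the minimizers. The obstacle is that a cost is
    merely in L^2 and bounded below. Adding mass can only be charged to ||c|| by Cauchy-Schwarz, so
    an addition must have L^2 norm O(t). Removing mass is charged to |clow|, so it suffices that the
    removed mass is O(t), whatever its L^2 norm. This explains the shape of the repair: a
    multiplicative removal, of which only the mass is estimated, followed by an addition that is
    small in L^2. Starting from the midpoint of s and s' lets one and the same plan be repaired for
    both pairs of marginals, and brings in the convexity gain in both comparisons. Since the
    solution is a choice from the set of minimizers, this set must also be shown to be nonempty;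
    here convexity makes a minimizing sequence Cauchy in norm, so that completeness of L^2 replaces
    weak compactness. *)

Section square_integrable.
Context d (T : measurableType d) (R : realType) (mu : {measure set T -> \bar R}).
Implicit Types (f g h : T -> R) (k : R).

Definition sqint f := measurable_fun setT f /\
  mu.-integrable setT (EFin \o (fun x => f x ^+ 2)).

Definition ip f g := \int[mu]_x (f x * g x).

Definition nrm f := Num.sqrt (ip f f).

Lemma sqint_le f g : measurable_fun setT f -> sqint g ->
  (forall x, `|f x| <= `|g x|) -> sqint f.
Proof.
move=> mf [mg ig] fg; split=> //; apply: le_integrable ig => //.
  by apply/measurable_EFinP; exact: measurable_funX.
by move=> x _ /=; rewrite lee_fin !normrX lerXn2r ?nnegrE.
Qed.

Lemma integrable_sqintM f g : sqint f -> sqint g ->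
  mu.-integrable setT (EFin \o (fun x => f x * g x)).
Proof.
move=> [mf sf] [mg sg].
apply: (@le_integrable _ _ _ mu _ measurableT _
  (fun x => (EFin \o (fun x => f x ^+ 2)%R) x + (EFin \o (fun x => g x ^+ 2)%R) x)%E).
- by apply/measurable_EFinP; exact: measurable_funM.
- move=> x _ /=; rewrite lee_fin normrM [leRHS]ger0_norm ?addr_ge0 ?sqr_ge0//.
  rewrite -[f x ^+ 2]real_normK ?num_real// -[g x ^+ 2]real_normK ?num_real//.
  by have := normr_ge0 (f x); have := normr_ge0 (g x); nra.
- exact: integrableD.
Qed.

Lemma sqintD f g : sqint f -> sqint g -> sqint (f \+ g).
Proof.
move=> sf sg; split; first by apply: measurable_funD; [case: sf|case: sg].
rewrite (_ : _ \o _ = (fun x => (EFin \o (fun x => f x ^+ 2)%R) x +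
    (EFin \o (fun x => f x * g x)%R) x + (EFin \o (fun x => f x * g x)%R) x +
    (EFin \o (fun x => g x ^+ 2)%R) x)%E).
  have ifg := integrable_sqintM sf sg.
  case: sf => _ sf; case: sg => _ sg.
  by do 3 (apply: integrableD => //).
by apply/funext => x /=; rewrite -!EFinD; congr EFin; ring.
Qed.

Lemma sqintZ k f : sqint f -> sqint (k \*o f).
Proof.
move=> [mf sf]; split; first exact: measurable_funM.
rewrite (_ : _ \o _ = (fun x => (k ^+ 2)%:E * (EFin \o (fun x => f x ^+ 2)%R) x)%E).
  exact: integrableZl.
by apply/funext => x /=; rewrite -EFinM exprMn.
Qed.

Lemma sqintB f g : sqint f -> sqint g -> sqint (f \- g).
Proof.
move=> sf sg; rewrite (_ : _ \- _ = f \+ (-1 \*o g)); last first.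
  by apply/funext => x /=; rewrite mulN1r.
exact/sqintD/sqintZ.
Qed.

Lemma sqintM_bounded f (u : T -> R) : measurable_fun setT u ->
  (forall x, 0 <= u x <= 1) -> sqint f -> sqint (f \* u).
Proof.
move=> mesu u01 sf; apply: (sqint_le _ sf).
  by apply: measurable_funM => //; case: sf.
by move=> x /=; have /andP[u0 u1] := u01 x; rewrite normrM (ger0_norm u0) ler_piMr.
Qed.

Lemma ipC f g : ip f g = ip g f.
Proof. by apply: eq_Rintegral => x _; rewrite mulrC. Qed.

Lemma eq_ip f g f' g' : (forall x, f x * g x = f' x * g' x) -> ip f g = ip f' g'.
Proof. by move=> fg; apply: eq_Rintegral => x _. Qed.

Lemma ipDl f g h : sqint f -> sqint g -> sqint h -> ip (f \+ g) h = ip f h + ip g h.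
Proof.
move=> sf sg sh; rewrite -RintegralD//; [|exact: integrable_sqintM..].
by apply: eq_Rintegral => x _ /=; rewrite mulrDl.
Qed.

Lemma ipZl k f h : sqint f -> sqint h -> ip (k \*o f) h = k * ip f h.
Proof.
move=> sf sh; rewrite -RintegralZl//; [|exact: integrable_sqintM..].
by apply: eq_Rintegral => x _ /=; rewrite mulrA.
Qed.

Lemma ipBl f g h : sqint f -> sqint g -> sqint h -> ip (f \- g) h = ip f h - ip g h.
Proof.
move=> sf sg sh; rewrite -RintegralB//; [|exact: integrable_sqintM..].
by apply: eq_Rintegral => x _ /=; rewrite mulrBl.
Qed.

Lemma ipDr f g h : sqint f -> sqint g -> sqint h -> ip h (f \+ g) = ip h f + ip h g.
Proof. by move=> *; rewrite ipC ipDl// !(ipC h). Qed.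

Lemma ipZr k f h : sqint f -> sqint h -> ip h (k \*o f) = k * ip h f.
Proof. by move=> *; rewrite ipC ipZl// (ipC h). Qed.

Lemma ipBr f g h : sqint f -> sqint g -> sqint h -> ip h (f \- g) = ip h f - ip h g.
Proof. by move=> *; rewrite ipC ipBl// !(ipC h). Qed.

(** The difference of the integrands agrees almost everywhere with its absolute value, whose
    integral is nonnegative at once. *)
Lemma ae_le_ip f g f' g' : sqint f -> sqint g -> sqint f' -> sqint g' ->
  {ae mu, forall x, f x * g x <= f' x * g' x} -> ip f g <= ip f' g'.
Proof.
move=> sf sg sf' sg' fg; rewrite -lee_fin /ip /Rintegral.
have ifg := integrable_sqintM sf sg; have ifg' := integrable_sqintM sf' sg'.
rewrite !fineK//; [|exact: integrable_fin_num..].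
have fin1 : (\int[mu]_x (f x * g x)%:E)%E \is a fin_num by exact: integrable_fin_num.
have fin2 : (\int[mu]_x (f' x * g' x)%:E)%E \is a fin_num by exact: integrable_fin_num.
rewrite -sube_ge0 ?fin1// -integralB//.
rewrite (@ae_eq_integral _ _ _ mu setT
  (fun x => `|(f' x * g' x)%:E - (f x * g x)%:E|)%E)//; first exact: integral_ge0.
- by apply: emeasurable_funB; apply: (measurable_int mu).
- by apply: measurableT_comp => //; apply: emeasurable_funB; apply: (measurable_int mu).
- by apply: filterS fg => x fg _; rewrite /= ger0_norm// subr_ge0.
Qed.

Lemma ae_eq_ip f g f' g' : sqint f -> sqint g -> sqint f' -> sqint g' ->
  {ae mu, forall x, f x * g x = f' x * g' x} -> ip f g = ip f' g'.
Proof.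
move=> sf sg sf' sg' fg; apply/eqP; rewrite eq_le; apply/andP; split;
  apply: ae_le_ip => //; by apply: filterS fg => x ->.
Qed.

Lemma ip_ge0 f g : {ae mu, forall x, 0 <= f x * g x} -> sqint f -> sqint g ->
  0 <= ip f g.
Proof.
move=> fg sf sg; rewrite -(mul0r (ip f g)) -ipZl//.
by apply: ae_le_ip => //; [exact: sqintZ|apply: filterS fg => x /=; rewrite !mul0r].
Qed.

Lemma ipxx_ge0 f : 0 <= ip f f.
Proof. by apply: Rintegral_ge0 => x _; rewrite -expr2 sqr_ge0. Qed.

Lemma nrm_ge0 f : 0 <= nrm f. Proof. exact: sqrtr_ge0. Qed.

Lemma sqr_nrm f : nrm f ^+ 2 = ip f f.
Proof. by rewrite sqr_sqrtr// ipxx_ge0. Qed.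

Lemma cauchy_schwarz f g : sqint f -> sqint g -> ip f g <= nrm f * nrm g.
Proof.
move=> sf sg; have [g0|g0] := eqVneq (nrm g) 0.
  rewrite g0 mulr0.
  (* If [nrm g = 0], the squared norm of [f - k g] is affine in [k]; being nonnegative for every
     [k], it leaves no room for [ip f g > 0]. *)
  have Hk k : 2 * k * ip f g <= ip f f.
    have := ipxx_ge0 (f \- (k \*o g)).
    have skg := sqintZ k sg; have sfg := sqintB sf skg.
    rewrite ipBl// !ipBr// !ipZr// !ipZl// (ipC g f) -(sqr_nrm g) g0; lra.
  rewrite leNgt; apply/negP => fg0.
  (* These two values of [k] give [ip f f <= 0] and [2 <= ip f f]. *)
  have := Hk (ip f f / ip f g); rewrite -mulrA divfK ?gt_eqF//.
  have := Hk (1 / ip f g); rewrite -mulrA divfK ?gt_eqF//.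
  lra.
have {}g0 : 0 < nrm g by rewrite lt_neqAle eq_sym g0 nrm_ge0.
(* With [a = nrm f] and [b = nrm g] this expands to [2 a b (a b - ip f g) >= 0]. Cancelling [2 a b]
   requires [a > 0], so [a = 0] is treated apart. *)
have := ipxx_ge0 ((nrm g \*o f) \- (nrm f \*o g)).
have s1 := sqintZ (nrm g) sf; have s2 := sqintZ (nrm f) sg.
rewrite ipBl ?ipBr ?ipZr ?ipZl//; [|exact: sqintB].
rewrite (ipC g f) -!sqr_nrm => H.
have [f0|f0] := eqVneq (nrm f) 0.
  rewrite f0 mul0r leNgt; apply/negP => fg0.
  have Hk k : 2 * k * ip f g <= k ^+ 2 * ip g g.
    have := ipxx_ge0 (f \- (k \*o g)).
    have skg := sqintZ k sg; have sfg := sqintB sf skg.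
    rewrite ipBl// !ipBr// !ipZr// !ipZl// (ipC g f) -(sqr_nrm f) f0; lra.
  have gg0 : 0 < ip g g by rewrite -sqr_nrm exprn_gt0.
  have := Hk (ip f g / ip g g).
  rewrite [X in _ <= X](_ : _ = (ip f g) * (ip f g / ip g g)); last by field; lra.
  have := divr_gt0 fg0 gg0; nra.
have {}f0 : 0 < nrm f by rewrite lt_neqAle eq_sym f0 nrm_ge0.
have fg0 : 0 < 2 * (nrm f * nrm g) by rewrite mulr_gt0// mulr_gt0.
by rewrite -(ler_pM2l fg0); nra.
Qed.

Lemma nrmZ k f : sqint f -> nrm (k \*o f) = `|k| * nrm f.
Proof.
move=> sf; rewrite /nrm ipZl//; last exact: sqintZ.
by rewrite ipZr// mulrA -expr2 sqrtrM ?sqr_ge0// sqrtr_sqr.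
Qed.

Lemma le_ip_nrmM f g : sqint f -> sqint g -> `|ip f g| <= nrm f * nrm g.
Proof.
move=> sf sg; rewrite ler_norml cauchy_schwarz// andbT lerNl.
rewrite (_ : - ip f g = ip (-1 \*o f) g); last by rewrite ipZl// mulN1r.
rewrite (le_trans (cauchy_schwarz _ _))//; first exact: sqintZ.
by rewrite nrmZ// normrN1 mul1r.
Qed.

Lemma ler_nrmD f g : sqint f -> sqint g -> nrm (f \+ g) <= nrm f + nrm g.
Proof.
move=> sf sg; rewrite -[leRHS]ger0_norm ?addr_ge0 ?nrm_ge0// -sqrtr_sqr ler_sqrt ?sqr_ge0//.
rewrite ipDl ?ipDr//; last exact: sqintD.
rewrite (ipC g f) -!sqr_nrm; have := cauchy_schwarz sf sg; nra.
Qed.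

Lemma ler_nrmB f g : sqint f -> sqint g -> nrm (f \- g) <= nrm f + nrm g.
Proof.
move=> sf sg; rewrite (_ : f \- g = f \+ (-1 \*o g)); last first.
  by apply/funext => x /=; rewrite mulN1r.
rewrite (le_trans (ler_nrmD _ _))//; first exact: sqintZ.
by rewrite nrmZ// normrN1 mul1r.
Qed.

Lemma ae_le_nrm f g : sqint f -> sqint g ->
  {ae mu, forall x, `|f x| <= `|g x|} -> nrm f <= nrm g.
Proof.
move=> sf sg fg; rewrite ler_sqrt ?ipxx_ge0//; apply: ae_le_ip => //.
by apply: filterS fg => x fg; rewrite -!expr2 -real_normK ?num_real// -[leRHS]real_normK
  ?num_real// lerXn2r ?nnegrE.
Qed.

Lemma nrm0_ae_eq0 f : sqint f -> ip f f <= 0 -> {ae mu, forall x, f x = 0}.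
Proof.
move=> sf ff.
have /ae_eq_integral_abs : measurable_fun setT (EFin \o (fun x => f x ^+ 2)).
  by case: sf => mf _; apply/measurable_EFinP; exact: measurable_funX.
move=> /(_ mu measurableT)[+ _].
have /[swap]/[apply] :
    (\int[mu]_x `|(EFin \o (fun x => f x ^+ 2)%R) x| = 0)%E.
  have iff := integrable_sqintM sf sf.
  rewrite (eq_integral (fun x => (f x * f x)%:E)); last first.
    by move=> x _ /=; rewrite ger0_norm ?sqr_ge0// expr2.
  rewrite -[LHS]fineK; last exact: integrable_fin_num.
  by congr EFin; apply/eqP; rewrite eq_le ff ipxx_ge0.
by apply: filterS => x /(_ I) /= [] /eqP; rewrite sqrf_eq0 => /eqP.
Qed.

(** Test against the positive part [h] of [f - g]: since [h^2 = (f - g) h], its norm vanishes. This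
    is how pointwise bounds are recovered from weak ones. *)
Lemma ae_le_of_ip f g : sqint f -> sqint g ->
  (forall h, sqint h -> (forall x, 0 <= h x) -> ip f h <= ip g h) ->
  {ae mu, forall x, f x <= g x}.
Proof.
move=> sf sg fg; have sfg := sqintB sf sg.
pose h x := Num.max 0 (f x - g x).
have sh : sqint h.
  apply: (sqint_le _ sfg); first by apply: measurable_maxr => //; case: sfg.
  by move=> x; rewrite /h; case: (lerP 0 (f x - g x)) => // _; rewrite normr0.
have h0 x : 0 <= h x by rewrite /h le_max lexx.
have : ip h h <= 0.
  have -> : ip h h = ip (f \- g) h.
    by apply: eq_ip => x; rewrite /h/=; case: (lerP 0 (f x - g x)) => // _; rewrite !mulr0.
  by rewrite ipBl// subr_le0 fg.
move=> /(nrm0_ae_eq0 sh); apply: filterS => x.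
by rewrite /h; case: (lerP 0 (f x - g x)) => H; [move=> E; lra|lra].
Qed.

Lemma sqint_indic (D : set T) : measurable D -> (mu D < +oo)%E -> sqint \1_D.
Proof.
move=> mD Dfin; split; first exact: measurable_indic.
apply/integrableP; split.
  by apply/measurable_EFinP/measurable_funX; exact: measurable_indic.
rewrite (eq_integral (EFin \o \1_D)); last first.
  move=> x _ /=; rewrite indicE; case: (_ \in _) => /=.
    by rewrite expr1n normr1.
  by rewrite expr0n normr0.
by rewrite integral_indic// setIT.
Qed.

End square_integrable.

(** * Completeness of L^2 with a geometric rate *)

Section riesz_fischer.
Context d (T : measurableType d) (R : realType) (mu : {measure set T -> \bar R}).
Implicit Types f g : T -> R.

Lemma ereal_ipE f g : sqint mu f -> sqint mu g ->
  (\int[mu]_x (f x * g x)%:E)%E = (ip mu f g)%:E.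
Proof.
move=> sf sg; rewrite /ip /Rintegral fineK//.
exact: (integrable_fin_num measurableT (integrable_sqintM sf sg)).
Qed.

Lemma sqint_lty f : measurable_fun setT f ->
  (\int[mu]_x (f x ^+ 2)%:E < +oo)%E -> sqint mu f.
Proof.
move=> mf foo; split=> //; apply/integrableP; split.
  by apply/measurable_EFinP; exact: measurable_funX.
rewrite (eq_integral (fun x => (f x ^+ 2)%:E))// => x _ /=.
by rewrite ger0_norm ?sqr_ge0.
Qed.

Lemma limn_einf_le (u : (\bar R)^nat) (c : \bar R) :
  (forall n, u n <= c)%E -> (limn_einf u <= c)%E.
Proof.
move=> uc; rewrite limn_einf_lim; apply: lime_le; first exact: is_cvg_einfs.
apply: nearW => n; apply: le_trans (uc n).
by apply: ereal_inf_lbound; exists n => /=.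
Qed.

(* By AM-GM, [2 `|d_n| <= 2^-n + 2^n d_n^2], and the right-hand side is
   summable almost everywhere. *)
Lemma ae_cvg_fast_cauchy (f : nat -> T -> R) : (forall n, sqint mu (f n)) ->
  (forall n, ip mu (f n.+1 \- f n) (f n.+1 \- f n) <= 4^-1 ^+ n) ->
  {ae mu, forall x, cvgn (fun n => f n x)}.
Proof.
move=> sf fC.
have sd n : sqint mu (f n.+1 \- f n) by exact: sqintB.
pose e n x := 2 ^+ n * (f n.+1 x - f n x) ^+ 2.
have e0 n x : 0 <= e n x by rewrite mulr_ge0 ?sqr_ge0// exprn_ge0.
have me n : measurable_fun setT (EFin \o e n).
  apply/measurable_EFinP; apply: measurable_funM => //.
  by apply: measurable_funX; case: (sd n).
have half_lt1 : `|2^-1 : R| < 1 by rewrite ger0_norm; lra.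
pose S : T -> \bar R := fun x => (\sum_(n <oo) (e n x)%:E)%E.
have iS : mu.-integrable setT S.
  apply/integrableP; split.
    by apply: ge0_emeasurable_sum; [move=> n x _ _; rewrite lee_fin|move=> n _; exact: me].
  rewrite (eq_integral S); last first.
    by move=> x _; rewrite gee0_abs//; apply: nneseries_ge0 => n _ _; rewrite lee_fin.
  rewrite integral_nneseries//; last by move=> n x _; rewrite lee_fin.
  (* Since [2^i * 4^-i = 2^-i], the integrals of the [e i] are dominated by a geometric series with
     sum [2]. *)
  apply: (@le_lt_trans _ _ 2%:E); last exact: ltry.
  apply: lime_le.
    by apply: is_cvg_nneseries => n _ _; apply: integral_ge0 => x _; rewrite lee_fin.
  apply: nearW => n; rewrite big_mkord.
  apply: (@le_trans _ _ (\sum_(i < n) (1 * 2^-1 ^+ i)%:E)%E).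
    apply: lee_sum => i _.
    rewrite (eq_integral (fun x => (2 ^+ i)%:E *
      ((f i.+1 \- f i) x * (f i.+1 \- f i) x)%:E)%E); last first.
      by move=> x _; rewrite -EFinM /e expr2.
    rewrite ge0_integralZl_EFin//; last 2 first.
    - by move=> x _; rewrite lee_fin -expr2 sqr_ge0.
    - by apply/measurable_EFinP; apply: measurable_funM; case: (sd i).
    - rewrite ereal_ipE// -EFinM lee_fin mul1r.
      rewrite (le_trans (ler_wpM2l _ (fC i)))//.
      by rewrite -exprMn (_ : 2 * 4^-1 = 2^-1)//; lra.
  rewrite sumEFin lee_fin.
  have := @geometric_le_lim R n 1 2^-1 ler01.
  rewrite /series/= big_mkord invr_gt0 ltr0n => /(_ isT half_lt1).
  by move=> /le_trans; apply; rewrite (_ : 1 - 2^-1 = 2^-1) ?mul1r ?invrK//; lra.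
have := integrable_ae measurableT iS; apply: filterS => x /(_ I) Sx.
have cd : cvgn (series (telescope (fun n => f n x))).
  apply: normed_cvg.
  apply: (@series_le_cvg _ _ (fun n => 2^-1 ^+ n + e n x)) => [n|n|n|] //=.
  - by rewrite addr_ge0// exprn_ge0// invr_ge0.
  - rewrite /telescope /e.
    have w0 : 0 < 2 ^+ n :> R by rewrite exprn_gt0.
    have wV : 2 ^+ n * 2^-1 ^+ n = 1 :> R by rewrite -exprMn divff ?expr1n.
    have z0 : 0 <= 2^-1 ^+ n :> R by rewrite exprn_ge0// invr_ge0.
    rewrite -[(f n.+1 x - f n x) ^+ 2]real_normK ?num_real//.
    set a := `|_|; have a0 : 0 <= a by exact: normr_ge0.
    have := sqr_ge0 (2 ^+ n * a - 1); rewrite sqrrB expr1n mulr1 exprMn.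
    move=> H; rewrite -(ler_pM2l w0) mulrDr wV; nra.
  - rewrite (_ : series _ = series (geometric 1 2^-1) \+ series (fun n => e n x)); last first.
      apply/funext => n; rewrite /series/= -big_split/=.
      by apply: eq_bigr => i _; rewrite mul1r.
    apply: is_cvgD; first exact: is_cvg_geometric_series.
    apply: nondecreasing_is_cvgn.
      by apply: nondecreasing_series => n _ _.
    exists (fine (S x)) => _ [n _ <-].
    rewrite -lee_fin fineK// /series/= -sumEFin.
    by apply: nneseries_lim_ge => i _ _; rewrite lee_fin.
rewrite (_ : (fun n => f n x) =
    (cst (f 0 x) \+ series (telescope (fun n => f n x)))); last first.
  by apply/funext => n /=; exact: (eq_sum_telescope (fun n => f n x)).
by apply: is_cvgD => //; exact: is_cvg_cst.
Qed.

(** Pointwise convergence comes from the fast Cauchy rate, and Fatou's lemma carries the same rate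
    over to the limit. Minimizing sequences can be chosen with this rate, so no subsequence has to
    be extracted. *)
Lemma riesz_fischer (f : nat -> T -> R) : (forall n, sqint mu (f n)) ->
  (forall n k, (n <= k)%N -> ip mu (f k \- f n) (f k \- f n) <= 4^-1 ^+ n) ->
  exists2 g, sqint mu g &
    forall n, ip mu (g \- f n) (g \- f n) <= 4^-1 ^+ n.
Proof.
(* The upper limit makes [g] measurable everywhere, also where the sequence diverges. *)
move=> sf fC; pose g x := fine (limn_esup (fun n => (f n x)%:E)).
have mf n : measurable_fun setT (f n) by case: (sf n).
have mg : measurable_fun setT g.
  apply: (measurableT_comp (@fine_measurable R setT measurableT)).
  by apply: measurable_fun_limn_esup => n; exact/measurable_EFinP.
have fg : {ae mu, forall x, f n x @[n --> \oo] --> g x}.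
  have := ae_cvg_fast_cauchy sf (fun n => fC n n.+1 (leqnSn n)).
  apply: filterS => x cfx.
  have cE : (f n x)%:E @[n --> \oo] --> (limn (fun n => f n x))%:E.
    by apply: cvg_EFin => //; exact: nearW.
  by rewrite /g (cvg_limn_einf_sup cE).
have gf n : (\int[mu]_x (((g \- f n) x) ^+ 2)%:E <= (4^-1 ^+ n)%:E)%E.
  pose u k x := (((f (k + n) \- f n) x) ^+ 2)%:E.
  have mu_ k : measurable_fun setT (u k).
    by apply/measurable_EFinP/measurable_funX; exact: measurable_funB.
  (* Fatou: almost everywhere the integrand is the lower limit of the squares of [f (k + n) - f n],
     whose integrals are all at most [4^-1 ^+ n]. *)
  rewrite (@ae_eq_integral _ _ _ mu setT (fun x => limn_einf (u ^~ x)))//.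
  - apply: (le_trans (fatou _ _ _ _)) => //.
      by move=> k x _; rewrite lee_fin sqr_ge0.
    apply: limn_einf_le => k.
    rewrite (eq_integral (fun x =>
      ((f (k + n) \- f n) x * (f (k + n) \- f n) x)%:E)); last by move=> x _; rewrite /u expr2.
    by rewrite ereal_ipE ?lee_fin ?fC ?leq_addl//; exact: sqintB.
  - by apply/measurable_EFinP/measurable_funX; exact: measurable_funB.
  - rewrite (_ : (fun x => _) = (fun x => - limn_esup (fun k => - u k x))%E); last first.
      apply/funext => x; rewrite -limn_einfN; congr limn_einf.
      by apply/funext => k; rewrite /comp oppeK.
    apply: measurableT_comp => //; apply: measurable_fun_limn_esup => k.
    exact: measurableT_comp.
  - apply: filterS fg => x fgx _.
    have : u k x @[k --> \oo] --> (((g \- f n) x) ^+ 2)%:E.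
      apply: cvg_EFin; first exact: nearW.
      rewrite /u/=.
      have cB : f (k + n)%N x - f n x @[k --> \oo] --> g x - f n x.
        apply: cvgB; last exact: cvg_cst.
        by rewrite (cvg_shiftn n (fun k => f k x)).
      exact: (cvgM cB cB).
    by move=> c; rewrite (cvg_limn_einf_sup c).
have sgf n : sqint mu (g \- f n).
  apply: sqint_lty; first exact: measurable_funB.
  by apply: le_lt_trans (gf n) _; exact: ltry.
exists g => [|n].
  rewrite (_ : g = (g \- f 0) \+ f 0); first exact: sqintD.
  by apply/funext => x /=; rewrite subrK.
rewrite -lee_fin -ereal_ipE//; apply: le_trans (gf n).
by under eq_integral do rewrite -expr2.
Qed.

End riesz_fischer.

(** * Tensor products and marginals *)

Section tensor.
Context d1 d2 (T1 : measurableType d1) (T2 : measurableType d2) (R : realType).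
Variables (m1 : {sigma_finite_measure set T1 -> \bar R}).
Variables (m2 : {sigma_finite_measure set T2 -> \bar R}).
Implicit Types (f phi : T1 -> R) (g psi : T2 -> R) (s : T1 * T2 -> R).

Definition tens f g (x : T1 * T2) : R := f x.1 * g x.2.

Lemma measurable_tens f g : measurable_fun setT f -> measurable_fun setT g ->
  measurable_fun setT (tens f g).
Proof.
move=> mf mg; apply: measurable_funM.
  exact: (measurableT_comp mf measurable_fst).
exact: (measurableT_comp mg measurable_snd).
Qed.

Lemma sqint_tens f g : sqint m1 f -> sqint m2 g -> sqint (m1 \x m2)%E (tens f g).
Proof.
move=> sf sg; have mf : measurable_fun setT f by case: sf.
have mg : measurable_fun setT g by case: sg.
have mfg := measurable_tens mf mg.
apply: sqint_lty => //.
rewrite fubini_tonelli1//=; last 2 first.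
- by apply/measurable_EFinP; exact: measurable_funX.
- by move=> x; rewrite lee_fin sqr_ge0.
rewrite /fubini_F (eq_integral (fun x => (f x * f x)%:E * (ip m2 g g)%:E)%E); last first.
  move=> x _; rewrite -ereal_ipE// -ge0_integralZl_EFin//.
  - by apply: eq_integral => y _; rewrite -EFinM /tens/= exprMn !expr2.
  - by move=> y _; rewrite lee_fin -expr2 sqr_ge0.
  - by apply/measurable_EFinP; exact: measurable_funM.
  - by rewrite -expr2 sqr_ge0.
rewrite ge0_integralZr ?ereal_ipE -?EFinM ?ltry//.
- by apply/measurable_EFinP; exact: measurable_funM.
- by move=> x _; rewrite lee_fin -expr2 sqr_ge0.
- by rewrite lee_fin ipxx_ge0.
Qed.

Lemma ip_tens f g f' g' : sqint m1 f -> sqint m2 g -> sqint m1 f' -> sqint m2 g' ->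
  ip (m1 \x m2)%E (tens f g) (tens f' g') = ip m1 f f' * ip m2 g g'.
Proof.
move=> sf sg sf' sg'; apply: EFin_inj.
have s1 := sqint_tens sf sg; have s2 := sqint_tens sf' sg'.
rewrite -ereal_ipE// -integral12_prod_meas1; last exact: integrable_sqintM.
have igg := integrable_sqintM sg sg'; have iff := integrable_sqintM sf sf'.
rewrite /fubini_F (eq_integral (fun x => (f x * f' x)%:E * (ip m2 g g')%:E)%E).
  by rewrite integralZr// ereal_ipE.
move=> x _; rewrite -ereal_ipE// -integralZl//.
by apply: eq_integral => y _; rewrite -EFinM /tens/= mulrACA.
Qed.

Lemma nrm_tens f g : sqint m1 f -> sqint m2 g ->
  nrm (m1 \x m2)%E (tens f g) = nrm m1 f * nrm m2 g.
Proof. by move=> sf sg; rewrite /nrm ip_tens// sqrtrM// ipxx_ge0. Qed.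

Lemma ae_fst (A : T1 -> Prop) : {ae m1, forall x, A x} ->
  {ae (m1 \x m2)%E, forall x, A x.1}.
Proof.
move=> [N [mN N0 AN]]; exists (N `*` setT); split.
- exact: measurableX.
- transitivity (m1 N * m2 setT)%E; first exact: product_measure1E.
  by rewrite [X in (X * _)%E](_ : _ = 0) ?mul0e.
- by move=> x /= nA; split => //; exact: AN.
Qed.

Lemma ae_snd (A : T2 -> Prop) : {ae m2, forall x, A x} ->
  {ae (m1 \x m2)%E, forall x, A x.2}.
Proof.
move=> [N [mN N0 AN]]; exists (setT `*` N); split.
- exact: measurableX.
- transitivity (m1 setT * m2 N)%E; first exact: product_measure1E.
  by rewrite [X in (_ * X)%E](_ : _ = 0) ?mule0.
- by move=> x /= nA; split => //; exact: AN.
Qed.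

(** [fine] sends an infinite slice integral to [0]. For square-integrable [s] supported in a box of
    finite measure, [ae_marg_fin] confines this to a null set. *)
Definition marg s x := fine (\int[m2]_y (s (x, y))%:E).

Section marginal.
Variables (D1 : set T1) (D2 : set T2).
Hypotheses (mD1 : measurable D1) (mD2 : measurable D2).
Hypotheses (D1_fin : (m1 D1 < +oo)%E) (D2_fin : (m2 D2 < +oo)%E).

Variable s : T1 * T2 -> R.
Hypothesis ss : sqint (m1 \x m2)%E s.
Hypothesis supp_s : forall x, ~ (D1 `*` D2) x -> s x = 0.

Let ms : measurable_fun setT s. Proof. by case: ss. Qed.

Let s_indic x : s x * tens \1_D1 \1_D2 x = s x.
Proof.
have [[D1x D2x]|nDx] := pselect ((D1 `*` D2) x).
  by rewrite /tens !indicE !mem_set// !mulr1.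
by rewrite supp_s// mul0r.
Qed.

Let is_ : (m1 \x m2)%E.-integrable setT (EFin \o s).
Proof.
have := integrable_sqintM ss (sqint_tens (sqint_indic mD1 D1_fin) (sqint_indic mD2 D2_fin)).
by under [X in _.-integrable _ (_ \o X) -> _]eq_fun do rewrite s_indic.
Qed.

Lemma ae_marg_fin : {ae m1, forall x, (\int[m2]_y (s (x, y))%:E = (marg s x)%:E)%E}.
Proof.
have := ae_integrable1 is_; apply: filterS => x ix; rewrite /marg fineK//.
exact: (integrable_fin_num measurableT ix).
Qed.

(** Cauchy-Schwarz on each slice against [\1_D2] bounds the square of the marginal by the measure of
    [D2] times the slice integral of [s^2]; then integrate by Tonelli. *)
Lemma sqint_marg : sqint m1 (marg s).
Proof.
have mm : measurable_fun setT (marg s).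
  apply: (measurableT_comp (@fine_measurable R setT measurableT)).
  exact: (measurable_fubini_F is_).
have ms2 : measurable_fun setT (fun x => ((s x) ^+ 2)%:E).
  by apply/measurable_EFinP; exact: measurable_funX.
have s2_ge0 : forall x, (0 <= ((s x) ^+ 2)%:E)%E by move=> x; rewrite lee_fin sqr_ge0.
have sD2 := sqint_indic mD2 D2_fin.
apply: sqint_lty => //.
have [_ s2] := ss.
apply: (@le_lt_trans _ _ (\int[m1]_x ((ip m2 \1_D2 \1_D2)%:E *
    \int[m2]_y ((s (x, y)) ^+ 2)%:E))%E).
  apply: ae_ge0_le_integral => //.
  - by move=> x _; rewrite lee_fin sqr_ge0.
  - by apply/measurable_EFinP; exact: measurable_funX.
  - by move=> x _; rewrite mule_ge0 ?lee_fin ?ipxx_ge0//; exact: integral_ge0.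
  - apply: emeasurable_funM; first exact: measurable_cst.
    exact: (measurable_fun_fubini_tonelli_F _ ms2 s2_ge0).
  - have := ae_integrable1 s2; apply: filterS => x i2 _.
    have sx : sqint m2 (fun y => s (x, y)).
      by split => //; exact: (measurableT_comp ms (measurable_pair1 x)).
    have -> : marg s x = ip m2 (fun y => s (x, y)) \1_D2.
      congr fine; apply: eq_integral => y _; congr EFin.
      rewrite indicE; case: (boolP (y \in D2)); rewrite ?mulr1// => /negP yD2.
      by rewrite supp_s ?mul0r// => -[_ /mem_set].
    rewrite (eq_integral (fun y => (s (x, y) * s (x, y))%:E)); last by move=> y _; rewrite expr2.
    rewrite ereal_ipE// -EFinM lee_fin -!sqr_nrm -exprMn mulrC.
    rewrite -[leLHS]real_normK ?num_real// lerXn2r ?nnegrE ?mulr_ge0 ?nrm_ge0//.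
    exact: le_ip_nrmM.
rewrite ge0_integralZl//; last 3 first.
- exact: (measurable_fun_fubini_tonelli_F _ ms2 s2_ge0).
- by move=> x _; exact: integral_ge0.
- by rewrite lee_fin ipxx_ge0.
rewrite -[X in (_ * X)%E](fubini_tonelli1 (fun x => (s x ^+ 2)%:E))//.
rewrite (eq_integral (fun x => (s x * s x)%:E)); last by move=> y _; rewrite expr2.
by rewrite ereal_ipE// -EFinM ltry.
Qed.

(** Fubini. The indicator [\1_D2] stands for the constant [1], which need not be square-integrable
    on the whole space; as [s] vanishes off [D2], nothing is lost. *)
Lemma ip_marg phi : sqint m1 phi ->
  ip (m1 \x m2)%E s (tens phi \1_D2) = ip m1 (marg s) phi.
Proof.
move=> sphi; have sD2 := sqint_indic mD2 D2_fin.
have st := sqint_tens sphi sD2.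
apply: EFin_inj; rewrite -!ereal_ipE//; last exact: sqint_marg.
have ist := integrable_sqintM ss st.
rewrite -integral12_prod_meas1//; apply: ae_eq_integral => //.
- exact: (measurable_fubini_F ist).
- by apply/measurable_EFinP; apply: measurable_funM; [case: sqint_marg|case: sphi].
- have := ae_integrable1 is_; apply: filterS => x ix _.
  rewrite /fubini_F EFinM /marg fineK; last exact: (integrable_fin_num measurableT ix).
  rewrite -integralZr//; apply: eq_integral => y _ /=; rewrite -EFinM; congr EFin.
  rewrite /tens/= indicE; case: (boolP (y \in D2)); rewrite ?mulr1// => /negP yD2.
  by rewrite supp_s ?mul0r// => -[_ /mem_set].
Qed.

(** For the converse, test with [phi = marg s - U], which is itself square-integrable. *)
Lemma marginal_weakP U : sqint m1 U ->
  {ae m1, forall x, (\int[m2]_y (s (x, y))%:E = (U x)%:E)%E} <->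
  (forall phi, sqint m1 phi -> ip (m1 \x m2)%E s (tens phi \1_D2) = ip m1 U phi).
Proof.
have smg := sqint_marg.
move=> sU; split=> [sE phi sphi|H].
  rewrite ip_marg//; apply: ae_eq_ip => //; apply: filterS2 ae_marg_fin sE.
  by move=> x -> [] ->.
have sB := sqintB smg sU.
have : ip m1 (marg s \- U) (marg s \- U) <= 0.
  by rewrite ipBl// -ip_marg// H// subrr.
move/(nrm0_ae_eq0 sB) => /=; apply: filterS2 ae_marg_fin => x -> /eqP.
by rewrite subr_eq0 => /eqP ->.
Qed.

End marginal.

(** Exchanging the factors lets every statement about first marginals serve for second marginals
    too. *)
Definition swap2 s : T2 * T1 -> R := fun x => s (x.2, x.1).

Lemma sqint_swap s : sqint (m1 \x m2)%E s -> sqint (m2 \x m1)%E (swap2 s).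
Proof.
move=> [ms is_]; split.
  apply: (measurableT_comp ms); exact: measurable_fun_pair.
apply/integrable12ltyP.
  apply/measurable_EFinP/measurable_funX.
  by apply: (measurableT_comp ms); exact: measurable_fun_pair.
apply/(@integrable21ltyP _ _ _ _ _ m1 m2 (EFin \o (fun x => s x ^+ 2))) => //.
by apply/measurable_EFinP/measurable_funX.
Qed.

Lemma ip_swap s s' : sqint (m1 \x m2)%E s -> sqint (m1 \x m2)%E s' ->
  ip (m2 \x m1)%E (swap2 s) (swap2 s') = ip (m1 \x m2)%E s s'.
Proof.
move=> ss ss'; have sw := sqint_swap ss; have sw' := sqint_swap ss'.
apply: EFin_inj; rewrite -!ereal_ipE//.
rewrite -integral12_prod_meas1; last exact: integrable_sqintM.
by rewrite -integral21_prod_meas1//; exact: integrable_sqintM.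
Qed.

End tensor.

Lemma swap2_tens d1 d2 (T1 : measurableType d1) (T2 : measurableType d2)
    (R : realType) (f : T1 -> R) (g : T2 -> R) : swap2 (tens f g) = tens g f.
Proof. by apply/funext => x; rewrite /swap2 /tens mulrC. Qed.

(** * Repairing the marginals of a plan *)

Definition supported {T : Type} {R : realType} (D : set T) (f : T -> R) :=
  forall x, ~ D x -> f x = 0.

Section truncated_ratio.
Context d (T : measurableType d) (R : realType) (mu : {measure set T -> \bar R}).
Variables (D : set T) (delta : R) (X U : T -> R).
Hypotheses (delta_gt0 : 0 < delta).
Hypotheses (sX : sqint mu X) (sU : sqint mu U).
Hypotheses (suppX : supported D X) (suppU : supported D U).
Hypothesis X_ge : {ae mu, forall x, D x -> delta <= X x}.
Hypothesis U_ge0 : {ae mu, forall x, D x -> 0 <= U x}.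

(* u = min(1, U / X) *)
Lemma truncated_ratio : exists u : T -> R,
  [/\ measurable_fun setT u, forall x, 0 <= u x <= 1,
    {ae mu, forall x, X x * u x <= U x},
    {ae mu, forall x, X x * (1 - u x) <= `|X x - U x|} &
    {ae mu, forall x, D x -> 1 - u x <= delta^-1 * `|X x - U x|}].
Proof.
(* Clamping to [0, 1] gives the bounds on [u] everywhere, even where [X >= delta] or [U >= 0]
   fails. *)
pose u x := Num.min 1 (Num.max 0 (U x * X x `^ (-1))).
have uE x : D x -> delta <= X x -> 0 <= U x ->
    (U x <= X x /\ X x * u x = U x) \/ (X x <= U x /\ u x = 1).
  move=> Dx dX U0; have X0 : 0 < X x by exact: lt_le_trans dX.
  rewrite /u powR_inv1; last exact: ltW.
  rewrite max_r; last exact: divr_ge0 (ltW X0).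
  have [UX|XU] := leP (U x) (X x).
    by left; split=> //; rewrite min_r ?ler_pdivrMr ?mul1r// mulrC divfK ?gt_eqF.
  by right; split; [exact: ltW|rewrite min_l// ler_pdivlMr// mul1r ltW].
have u01 x : 0 <= u x <= 1.
  by rewrite /u le_min ler01 le_max lexx/= ge_min lexx.
exists u; split => //.
- apply: measurable_minr => //; apply: measurable_maxr => //.
  apply: measurable_funM; first by case: sU.
  by apply: (measurableT_comp (measurable_powR _)); case: sX.
- apply: filterS2 X_ge U_ge0 => x Xx Ux.
  have [Dx|Dx] := pselect (D x); last by rewrite suppX// suppU// mul0r.
  by have [[_ ->]|[XU ->]] := uE x Dx (Xx Dx) (Ux Dx); rewrite ?mulr1.
- apply: filterS2 X_ge U_ge0 => x Xx Ux.
  have [Dx|Dx] := pselect (D x); last by rewrite suppX// mul0r.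
  have [[UX XuU]|[XU ->]] := uE x Dx (Xx Dx) (Ux Dx); last by rewrite subrr mulr0.
  by rewrite mulrBr mulr1 XuU ler_norm.
- apply: filterS2 X_ge U_ge0 => x Xx Ux Dx.
  have {Ux} := uE x Dx (Xx Dx) (Ux Dx); have {Xx} := Xx Dx.
  move=> dX [[UX XuU]|[XU ->]]; last by rewrite subrr mulr_ge0// invr_ge0 ltW.
  rewrite ger0_norm ?subr_ge0// mulrC ler_pdivlMr// -XuU.
  by have := u01 x; nra.
Qed.

End truncated_ratio.

Section residual.
Context d1 d2 (T1 : measurableType d1) (T2 : measurableType d2) (R : realType).
Variables (m1 : {sigma_finite_measure set T1 -> \bar R}).
Variables (m2 : {sigma_finite_measure set T2 -> \bar R}).
Variables (D1 : set T1) (D2 : set T2).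
Hypotheses (mD1 : measurable D1) (mD2 : measurable D2).
Hypotheses (D1_fin : (m1 D1 < +oo)%E) (D2_fin : (m2 D2 < +oo)%E).
Local Notation P := (m1 \x m2)%E.

Definition damp (t : R) (s : T1 * T2 -> R) (u1 : T1 -> R) (u2 : T2 -> R) :=
  (1 - t) \*o (s \* tens u1 u2).

Lemma sqint_damp t s (u1 : T1 -> R) (u2 : T2 -> R) : sqint P s ->
  measurable_fun setT u1 -> measurable_fun setT u2 ->
  (forall x, 0 <= u1 x <= 1) -> (forall x, 0 <= u2 x <= 1) ->
  sqint P (damp t s u1 u2).
Proof.
move=> ss mu1 mu2 u1b u2b; apply: sqintZ; apply: sqintM_bounded => //.
  exact: measurable_tens.
move=> x; have /andP[? ?] := u1b x.1; have /andP[? ?] := u2b x.2.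
by rewrite /tens mulr_ge0//= mulr_ile1.
Qed.

Variables (t delta M B : R) (s : T1 * T2 -> R).
Variables (X1 U1 u1 : T1 -> R) (u2 v2 : T2 -> R).
Hypotheses (t_gt0 : 0 < t) (t_le1 : t <= 1) (delta_gt0 : 0 < delta).
Hypotheses (ss : sqint P s) (supp_s : supported (D1 `*` D2) s).
Hypotheses (s_ge0 : {ae P, forall x, 0 <= s x}) (s_le : nrm P s <= B).
Hypotheses (sX1 : sqint m1 X1) (X1_le : nrm m1 X1 <= M).
Hypothesis (s_X1 : forall phi, sqint m1 phi ->
  ip P s (tens phi \1_D2) = ip m1 X1 phi).
Hypotheses (sU1 : sqint m1 U1) (suppU1 : supported D1 U1).
Hypotheses (U1_ge0 : {ae m1, forall x, 0 <= U1 x}).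
Hypotheses (XU1 : nrm m1 (X1 \- U1) <= t).
Hypotheses (mu1 : measurable_fun setT u1) (u1b : forall x, 0 <= u1 x <= 1).
Hypotheses (mu2 : measurable_fun setT u2) (u2b : forall x, 0 <= u2 x <= 1).
Hypotheses (X1u1 : {ae m1, forall x, X1 x * u1 x <= U1 x}).
Hypotheses (X1u1' : {ae m1, forall x, X1 x * (1 - u1 x) <= `|X1 x - U1 x|}).
Hypotheses (sv2 : sqint m2 v2) (v2_le : nrm m2 v2 <= delta^-1 * t).
Hypotheses (u2v2 : {ae m2, forall x, D2 x -> 1 - u2 x <= v2 x}).

(* The deficit [r] of the first marginal of the damped plan. Its norm is
   bounded by testing its defining identity against [r] itself. *)
Lemma residual : exists r, [/\ sqint m1 r, supported D1 r,
  forall phi, sqint m1 phi ->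
    ip P (damp t s u1 u2) (tens phi \1_D2) = ip m1 U1 phi - ip m1 r phi,
  {ae m1, forall x, t * U1 x <= r x} &
  nrm m1 r <= (2 + M + B / delta) * t].
Proof.
have sD2 := sqint_indic mD2 D2_fin.
have sp := sqint_damp t ss mu1 mu2 u1b u2b.
have supp_p : supported (D1 `*` D2) (damp t s u1 u2).
  by move=> x /supp_s sx; rewrite /damp/= sx mul0r mulr0.
have sP1 := sqint_marg mD1 mD2 D1_fin D2_fin sp supp_p.
have ipP1 := ip_marg mD1 mD2 D1_fin D2_fin sp supp_p.
pose r := U1 \- marg m2 (damp t s u1 u2).
have sr : sqint m1 r by exact: sqintB.
have t1 : 0 <= 1 - t by rewrite subr_ge0.
have r_ge : {ae m1, forall x, t * U1 x <= r x}.
  (* Shown by testing with [h >= 0]: dropping [u2 <= 1] leaves [1 - t] times the pairing of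
     [X1 * u1] with [h], and [X1 * u1 <= U1]. *)
  have : {ae m1, forall x, marg m2 (damp t s u1 u2) x <= (1 - t) * U1 x}.
    apply: (@ae_le_of_ip _ _ _ m1 _ ((1 - t) \*o U1)) => //; first exact: sqintZ.
    move=> h sh h0; rewrite -ipP1// [leRHS]ipZl//.
    have shu : sqint m1 (h \* u1) by exact: sqintM_bounded.
    apply: (@le_trans _ _ (ip P ((1 - t) \*o s) (tens (h \* u1) \1_D2))).
      apply: ae_le_ip => //; [exact: sqint_tens|exact: sqintZ|exact: sqint_tens|].
      apply: filterS s_ge0 => x s0; rewrite /damp/tens/= -!mulrA ler_wpM2l//.
      rewrite ler_wpM2l//; have /andP[u0 _] := u1b x.1; have /andP[_ u1'] := u2b x.2.
      rewrite [X in X <= _](_ : _ = (h x.1 * u1 x.1 * \1_D2 x.2) * u2 x.2); last by ring.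
      by rewrite [X in _ <= X]mulrA ler_piMr// !mulr_ge0.
    rewrite ipZl//; last exact: sqint_tens.
    rewrite ler_wpM2l// s_X1//; apply: ae_le_ip => //.
    apply: filterS X1u1 => x Xu /=; rewrite mulrCA [leRHS]mulrC ler_wpM2l//.
  by apply: filterS => x; rewrite /r/=; lra.
have r_ge0 : {ae m1, forall x, 0 <= r x}.
  by apply: filterS2 r_ge U1_ge0 => x + U0; apply: le_trans; rewrite mulr_ge0// ltW.
have ip_r phi : sqint m1 phi ->
    ip P (damp t s u1 u2) (tens phi \1_D2) = ip m1 U1 phi - ip m1 r phi.
  by move=> sphi; rewrite /r ipBl// ipP1// subKr.
exists r; split => //.
  move=> x D1x; rewrite /r/= suppU1// sub0r /marg integral0_eq ?oppr0// => y _.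
  by rewrite /damp/= supp_s ?mul0r ?mulr0// => -[].
have B0 : 0 <= B by exact: le_trans (nrm_ge0 _ _) s_le.
pose e1 x := `|X1 x - U1 x|.
have sXU : sqint m1 (X1 \- U1) by exact: sqintB.
have se1 : sqint m1 e1.
  apply: (sqint_le _ sXU); last by move=> x; rewrite normr_id.
  by apply: measurableT_comp => //; case: sXU.
have e1_le : nrm m1 e1 <= t.
  apply: le_trans XU1; apply: ae_le_nrm => //.
  by apply/aeW => x; rewrite normr_id.
have sru : sqint m1 (r \* (fun x => 1 - u1 x)).
  apply: sqintM_bounded => //; first exact: measurable_funB.
  by move=> x; have := u1b x; lra.
(* Origin of the constant: [U1 - X1] and the weighted error of [u1] contribute [t] each, the factor
   [1 - t] contributes [M t], and the error of [u2], paired with [s] itself, contributes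
   [B / delta * t]. *)
have rr : ip m1 r r <= nrm m1 r * ((2 + M + B / delta) * t).
  have -> : ip m1 r r = ip m1 (U1 \- X1) r +
      (ip P s (tens r \1_D2) - ip P (damp t s u1 u2) (tens r \1_D2)).
    by rewrite ip_r// s_X1// ipBl//; ring.
  have st1 := sqint_tens sr sD2.
  have st2 := sqint_tens sru sD2; have st3 := sqint_tens sr sv2.
  have le1 : ip m1 (U1 \- X1) r <= t * nrm m1 r.
    apply: (le_trans (cauchy_schwarz _ _)) => //; first exact: sqintB.
    rewrite ler_wpM2r ?nrm_ge0//; apply: le_trans XU1.
    apply: ae_le_nrm => //; first exact: sqintB.
    by apply/aeW => x /=; rewrite distrC.
  have le2 : ip P s (tens r \1_D2) - ip P (damp t s u1 u2) (tens r \1_D2) <=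
      t * ip m1 X1 r + ip m1 X1 (r \* (fun x => 1 - u1 x)) + ip P s (tens r v2).
    rewrite -s_X1// -s_X1// -ipZr// -ipBl// -ipDr//; last exact: sqintZ.
    rewrite -ipDr//; last by apply: sqintD => //; exact: sqintZ.
    apply: ae_le_ip => //; [exact: sqintB| |].
      by apply: sqintD => //; apply: sqintD => //; exact: sqintZ.
    have aer := @ae_fst _ _ _ _ _ m1 m2 _ r_ge0.
    have aev := @ae_snd _ _ _ _ _ m1 m2 _ u2v2.
    apply: filterS3 s_ge0 aer aev => x s0 r0 uv.
    have [[D1x D2x]|nDx] := pselect ((D1 `*` D2) x); last first.
      by rewrite /damp/= supp_s// !(mul0r, mulr0, subrr).
    rewrite /damp /tens/= indicE mem_set//=.
    have {}uv := uv D2x; have /andP[? ?] := u1b x.1; have /andP[? ?] := u2b x.2.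
    rewrite [X in X <= _](_ : _ = s x * (r x.1 * (1 - (1 - t) * (u1 x.1 * u2 x.2)))); last by ring.
    rewrite ler_wpM2l// [X in _ <= X](_ : _ = r x.1 * (t + (1 - u1 x.1) + v2 x.2)); last by ring.
    rewrite ler_wpM2l//.
    have tt := t_gt0.
    (* This and the next fact give [1 - (1 - t) u1 u2 <= t + (1 - u1) + (1 - u2)]. *)
    have : 0 <= (1 - u1 x.1) * (1 - u2 x.2) by rewrite mulr_ge0// subr_ge0.
    have : 0 <= t * (1 - u1 x.1 * u2 x.2).
      by apply: mulr_ge0; [exact: ltW|rewrite subr_ge0 mulr_ile1].
    nra.
  have le3 : ip m1 X1 r <= M * nrm m1 r.
    by rewrite (le_trans (cauchy_schwarz _ _))// ler_wpM2r ?nrm_ge0.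
  have le4 : ip m1 X1 (r \* (fun x => 1 - u1 x)) <= t * nrm m1 r.
    apply: (@le_trans _ _ (ip m1 e1 r)).
      apply: ae_le_ip => //; apply: filterS2 X1u1' r_ge0 => x Xu r0 /=.
      by rewrite mulrCA mulrC ler_wpM2r.
    by rewrite (le_trans (cauchy_schwarz _ _))// ler_wpM2r ?nrm_ge0.
  have le5 : ip P s (tens r v2) <= B / delta * t * nrm m1 r.
    rewrite (le_trans (cauchy_schwarz _ _))// nrm_tens//.
    rewrite -!mulrA ler_pM ?mulr_ge0 ?nrm_ge0//.
    by rewrite mulrC mulrA ler_wpM2r ?nrm_ge0.
  apply: le_trans (lerD le1 le2) _.
  have : t * ip m1 X1 r <= t * (M * nrm m1 r) by rewrite ler_wpM2l// ltW.
  lra.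
have [r0|r0] := eqVneq (nrm m1 r) 0.
  rewrite r0 !mulr_ge0// ?(ltW t_gt0)// !addr_ge0// ?divr_ge0// ?(ltW delta_gt0)//.
  exact: le_trans (nrm_ge0 _ _) X1_le.
by move: rr; rewrite -sqr_nrm expr2 ler_pM2l// lt_neqAle eq_sym r0 nrm_ge0.
Qed.

End residual.

(** * Plans with weak marginals, and existence of minimizers *)

Section plans.
Context d1 d2 (T1 : measurableType d1) (T2 : measurableType d2) (R : realType).
Variables (m1 : {sigma_finite_measure set T1 -> \bar R}).
Variables (m2 : {sigma_finite_measure set T2 -> \bar R}).
Variables (D1 : set T1) (D2 : set T2).
Hypotheses (mD1 : measurable D1) (mD2 : measurable D2).
Hypotheses (D1_fin : (m1 D1 < +oo)%E) (D2_fin : (m2 D2 < +oo)%E).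
Local Notation P := (m1 \x m2)%E.
Local Notation T12 := (T1 * T2)%type.
Implicit Types (U X : T1 -> R) (V Y : T2 -> R) (c s q : T12 -> R).

(** In this form the marginal constraints are linear and L^2-continuous in [s], so they pass to
    midpoints and to limits by properties of [ip] alone. *)
Definition plan U V s := [/\ sqint P s, supported (D1 `*` D2) s,
  {ae P, forall x, 0 <= s x},
  forall phi, sqint m1 phi -> ip P s (tens phi \1_D2) = ip m1 U phi &
  forall psi, sqint m2 psi -> ip P s (tens \1_D1 psi) = ip m2 V psi].

Definition cost (gamma : R) c s : R := ip P c s + gamma / 2 * ip P s s.

Let sD1 : sqint m1 \1_D1. Proof. exact: sqint_indic. Qed.
Let sD2 : sqint m2 \1_D2. Proof. exact: sqint_indic. Qed.

(** The product coupling serves twice: for the given marginals, as a competitor that shows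
    feasibility and bounds the minimizers; for the deficits of a damped plan, as the correction. *)
Lemma plan_tens (mass : R) U V : 0 < mass -> sqint m1 U -> sqint m2 V ->
  supported D1 U -> supported D2 V ->
  {ae m1, forall x, 0 <= U x} -> {ae m2, forall x, 0 <= V x} ->
  ip m1 U \1_D1 = mass -> ip m2 V \1_D2 = mass ->
  plan U V (mass^-1 \*o tens U V).
Proof.
move=> mass0 sU sV suppU suppV U0 V0 mU mV; have sUV := sqint_tens sU sV.
split; first exact: sqintZ.
- move=> x /= nD; rewrite /tens; have [Dx|Dx] := pselect (D1 x.1).
    by rewrite [V _]suppV ?mulr0// => D2x; apply: nD.
  by rewrite suppU// mul0r mulr0.
- have aU := @ae_fst _ _ _ _ _ m1 m2 _ U0; have aV := @ae_snd _ _ _ _ _ m1 m2 _ V0.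
  apply: filterS2 aU aV => x Ux Vx /=.
  by rewrite !mulr_ge0// invr_ge0 ltW.
- move=> phi sphi; rewrite ipZl//; last exact: sqint_tens.
  by rewrite ip_tens// mV mulrCA mulVf ?mulr1// gt_eqF.
- move=> psi spsi; rewrite ipZl//; last exact: sqint_tens.
  by rewrite ip_tens// mU mulrA mulVf ?mul1r// gt_eqF.
Qed.

Lemma plan_mid U V X Y s q : plan U V s -> plan X Y q ->
  sqint m1 U -> sqint m1 X -> sqint m2 V -> sqint m2 Y ->
  plan (2^-1 \*o (U \+ X)) (2^-1 \*o (V \+ Y)) (2^-1 \*o (s \+ q)).
Proof.
move=> [ss supps s0 sU sV] [sq suppq q0 qX qY] sU' sX' sV' sY'.
have ssq := sqintD ss sq; have sUX := sqintD sU' sX'; have sVY := sqintD sV' sY'.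
split; first exact: sqintZ.
- by move=> x nD /=; rewrite supps// suppq// addr0 mulr0.
- by apply: filterS2 s0 q0 => x s0 q0 /=; rewrite mulr_ge0 ?addr_ge0// invr_ge0.
- move=> phi sphi; have st := sqint_tens sphi sD2.
  by rewrite !ipZl// !ipDl// sU// qX.
- move=> psi spsi; have st := sqint_tens sD1 spsi.
  by rewrite !ipZl// !ipDl// sV// qY.
Qed.

(** The parallelogram law; the linear part of the cost is affine and adds nothing to the last
    term. *)
Lemma cost_mid (gamma : R) c s q : sqint P c -> sqint P s -> sqint P q ->
  cost gamma c (2^-1 \*o (s \+ q)) =
  (cost gamma c s + cost gamma c q) / 2 - gamma / 8 * ip P (s \- q) (s \- q).
Proof.
move=> sc ss sq; have ssq := sqintD ss sq; have sB := sqintB ss sq.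
have sZ := sqintZ 2^-1 ssq.
rewrite /cost !ipBr// !ipBl// ipZr// ipZl// ipZr// !ipDr// !ipDl// (ipC _ q s).
by field.
Qed.

(** Complete the square: the squared norm of [gamma s + c] is nonnegative. *)
Lemma cost_ge (gamma : R) c s : 0 < gamma -> sqint P c -> sqint P s ->
  - (ip P c c / (2 * gamma)) <= cost gamma c s.
Proof.
move=> g0 sc ss; have sZ := sqintZ gamma ss.
have := ipxx_ge0 P ((gamma \*o s) \+ c).
rewrite ipDl ?ipDr ?ipZl ?ipZr//; last exact: sqintD.
rewrite (ipC _ s c) => H; rewrite -subr_ge0 /cost.
have g20 : 0 < 2 * gamma by rewrite mulr_gt0.
rewrite -(pmulr_rge0 _ g20) [leRHS](_ : _ = gamma * (gamma * ip P s s) +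
  gamma * ip P c s + (gamma * ip P c s + ip P c c)); first by lra.
by field; rewrite gt_eqF.
Qed.

Lemma ler_geometric (x y C : R) : (forall n, x <= y + C * 2^-1 ^+ n) -> x <= y.
Proof.
move=> H.
have cv : y + C * 2^-1 ^+ n @[n --> \oo] --> y + C * 0.
  apply: cvgD; first exact: cvg_cst.
  by apply: cvgZl_tmp; apply: cvg_expr; rewrite ger0_norm; lra.
rewrite mulr0 addr0 in cv; rewrite -(cvg_lim _ cv)//.
by apply: limr_ge; [apply/cvg_ex; exists y|apply: nearW].
Qed.

(** By [cost_mid], [gamma / 8] times the squared distance of two plans is at most the mean of their
    excesses over the infimum. Excesses [gamma / 8 * 4^-1 ^+ n] thus give exactly the rate that
    [riesz_fischer] asks for. *)
Lemma exists_minimizer (gamma : R) c U V : 0 < gamma -> sqint P c ->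
  sqint m1 U -> sqint m2 V -> (exists s, plan U V s) ->
  exists s, plan U V s /\ forall q, plan U V q -> cost gamma c s <= cost gamma c q.
Proof.
move=> g0 sc sU sV [s0 ps0].
have g8 : 0 < gamma / 8 by rewrite divr_gt0.
pose E := [set cost gamma c s | s in plan U V].
have infE : has_inf E.
  split; first by exists (cost gamma c s0), s0.
  exists (- (ip P c c / (2 * gamma))) => _ [s [ss _ _ _ _] <-]; exact: cost_ge.
have E_inf q : plan U V q -> inf E <= cost gamma c q.
  by move=> pq; apply: ge_inf; [exact: infE.2|exists q].
have eps0 n : 0 < gamma / 8 * 4^-1 ^+ n by rewrite mulr_gt0// ?divr_gt0// exprn_gt0.
have /choice[f fP] : forall n, exists s, plan U V s /\
    cost gamma c s <= inf E + gamma / 8 * 4^-1 ^+ n.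
  move=> n; have [_ [s ps <-] /ltW sE] := inf_adherent (eps0 n) infE.
  by exists s.
have sf n : sqint P (f n) by have [[]] := fP n.
have midE (W : Type) (F : W -> R) : 2^-1 \*o (F \+ F) = F.
  by apply/funext => x /=; lra.
have [|g sg gf] := riesz_fischer sf.
  move=> n k nk; have [pn fn] := fP n; have [pk fk] := fP k.
  have : inf E <= cost gamma c (2^-1 \*o (f k \+ f n)).
    by apply: E_inf; have := plan_mid pk pn sU sU sV sV; rewrite !midE.
  rewrite cost_mid// => H.
  have : gamma / 8 * 4^-1 ^+ k <= gamma / 8 * 4^-1 ^+ n.
    by rewrite (ler_pM2l g8) ler_wiXn2l//; lra.
  by move=> H'; rewrite -(ler_pM2l g8); lra.
have mD : measurable_fun setT (tens (\1_D1 : T1 -> R) (\1_D2 : T2 -> R)).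
  by apply: measurable_tens; exact: measurable_indic.
(* [supported] is a condition at every point, which an L^2 limit need not satisfy. Cutting off does
   not increase the distance to [f n], which vanishes off the box. *)
pose h := g \* tens \1_D1 \1_D2.
have sh : sqint P h.
  by apply: sqintM_bounded => // x; rewrite /tens mulr_ge0//= mulr_ile1// indicE lern1 leq_b1.
have supph : supported (D1 `*` D2) h.
  move=> x nD; rewrite /h /tens /= !indicE.
  have [D1x|D1x] := pselect (D1 x.1); last by rewrite memNset// mul0r mulr0.
  by rewrite [x.2 \in _]memNset ?mulr0// => D2x; apply: nD.
have hf n : nrm P (h \- f n) <= 2^-1 ^+ n.
  have -> : (2^-1 : R) ^+ n = Num.sqrt (4^-1 ^+ n).
    rewrite (_ : 4^-1 = 2^-1 ^+ 2); last by lra.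
    by rewrite exprAC sqrtr_sqr ger0_norm// exprn_ge0// invr_ge0.
  rewrite ler_wsqrtr//; apply: le_trans (gf n).
  have sB := sqintB sh (sf n); have sB' := sqintB sg (sf n).
  apply: ae_le_ip => //; apply/aeW => x /=.
  have [[D1x D2x]|nD] := pselect ((D1 `*` D2) x).
    by rewrite /h/tens/= !indicE !mem_set// !mulr1.
  have [[_ sf0 _ _ _] _] := fP n; rewrite supph// sf0// subr0 mul0r subr0.
  by rewrite -expr2 sqr_ge0.
have ipB n k : sqint P k -> `|ip P h k - ip P (f n) k| <= nrm P k * 2^-1 ^+ n.
  move=> sk; rewrite -ipBl// mulrC (le_trans (le_ip_nrmM _ _))//; first exact: sqintB.
  by rewrite ler_wpM2r ?nrm_ge0.
have ip_lim k y : sqint P k -> (forall n, ip P (f n) k = y) -> ip P h k = y.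
  move=> sk fy; apply/eqP; rewrite eq_le; apply/andP; split.
    apply: (@ler_geometric _ _ (nrm P k)) => n; rewrite -(fy n) addrC -lerBlDr.
    by apply: le_trans (ler_norm _) _; exact: ipB.
  apply: (@ler_geometric _ _ (nrm P k)) => n; rewrite -{1}(fy n) addrC -lerBlDr.
  by apply: le_trans (ler_norm _) _; rewrite distrC; exact: ipB.
have ph : plan U V h.
  split => //.
  - have sz := sqintZ 0 sh.
    (* Nonnegativity passes to the limit in weak form, tested with [k >= 0]. *)
    have : {ae P, forall x, (0 \*o h) x <= h x}.
      apply: ae_le_of_ip => // k sk k0; rewrite ipZl// mul0r.
      apply: (@ler_geometric _ _ (nrm P k)) => n.
      apply: (@le_trans _ _ (ip P (f n) k)).
        apply: ip_ge0 => //; have [[_ _ f0 _ _] _] := fP n.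
        by apply: filterS f0 => x f0; rewrite mulr_ge0.
      rewrite addrC -lerBlDr; apply: le_trans (ler_norm _) _.
      by rewrite distrC; exact: ipB.
    by apply: filterS => x /=; rewrite mul0r.
  - move=> phi sphi; apply: ip_lim; first exact: sqint_tens.
    by move=> n; have [[_ _ _ H _] _] := fP n; exact: H.
  - move=> psi spsi; apply: ip_lim; first exact: sqint_tens.
    by move=> n; have [[_ _ _ _ H] _] := fP n; exact: H.
exists h; split => // q pq; apply: le_trans (E_inf _ pq).
apply: (@ler_geometric _ _ (gamma / 8 + (nrm P c + gamma * nrm P h))) => n.
have [_ fn] := fP n.
(* Exact expansion around [h]: the quadratic remainder has the favourable sign and is dropped, and
   the linear term is of order [2^-1 ^+ n]. *)
have -> : cost gamma c h = cost gamma c (f n) + (ip P (h \- f n) (c \+ (gamma \*o h)) -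
    gamma / 2 * ip P (h \- f n) (h \- f n)).
  have s1 := sqintZ gamma sh; have s2 := sqintD sc s1; have sfn := sf n.
  have s3 := sqintB sh sfn.
  rewrite /cost !ipBr// !ipBl// !ipDr// !ipZr// (ipC _ h c) (ipC _ (f n) c) (ipC _ (f n) h).
  by field.
have s1 : sqint P (c \+ (gamma \*o h)) by apply: sqintD => //; exact: sqintZ.
have H1 : ip P (h \- f n) (c \+ (gamma \*o h)) <= (nrm P c + gamma * nrm P h) * 2^-1 ^+ n.
  apply: le_trans (cauchy_schwarz _ _) _ => //; first exact: sqintB.
  rewrite mulrC ler_pM ?nrm_ge0//; apply: le_trans (ler_nrmD _ _) _ => //.
    exact: sqintZ.
  by rewrite nrmZ// gtr0_norm.
have H2 : 0 <= gamma / 2 * ip P (h \- f n) (h \- f n).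
  by rewrite mulr_ge0 ?ipxx_ge0// divr_ge0// ltW.
have H3 : gamma / 8 * 4^-1 ^+ n <= gamma / 8 * 2^-1 ^+ n.
  by rewrite (ler_pM2l g8) lerXn2r// ?nnegrE ?invr_ge0//; lra.
apply: le_trans (lerD fn (lerB H1 H2)) _.
by rewrite subr0 (mulrDl (gamma / 8)) (addrA (inf E)) lerD2r lerD2l.
Qed.

End plans.

(** * Stability of minimizers *)

Section stability.
Context d1 d2 (T1 : measurableType d1) (T2 : measurableType d2) (R : realType).
Variables (m1 : {sigma_finite_measure set T1 -> \bar R}).
Variables (m2 : {sigma_finite_measure set T2 -> \bar R}).
Variables (D1 : set T1) (D2 : set T2).
Hypotheses (mD1 : measurable D1) (mD2 : measurable D2).
Hypotheses (D1_fin : (m1 D1 < +oo)%E) (D2_fin : (m2 D2 < +oo)%E).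
Local Notation P := (m1 \x m2)%E.
Local Notation T12 := (T1 * T2)%type.
Local Notation plan := (plan m1 m2 D1 D2).
Local Notation cost := (cost m1 m2).
Implicit Types (U X : T1 -> R) (V Y : T2 -> R) (c s q : T12 -> R).

Let sD1 : sqint m1 \1_D1. Proof. exact: sqint_indic. Qed.
Let sD2 : sqint m2 \1_D2. Proof. exact: sqint_indic. Qed.

(** The null set is carried across by a norm: [min 0 s] has norm zero, and [swap2] preserves inner
    products. *)
Lemma ae_swap_ge0 s : sqint P s -> {ae P, forall x, 0 <= s x} ->
  {ae (m2 \x m1)%E, forall x, 0 <= swap2 s x}.
Proof.
move=> ss s0; pose h x := Num.min 0 (s x).
have sh : sqint P h.
  apply: (sqint_le _ ss); first by apply: measurable_minr => //; case: ss.
  by move=> x; rewrite /h; case: (lerP 0 (s x)) => // _; rewrite normr0.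
have := nrm0_ae_eq0 (sqint_swap sh); rewrite ip_swap// => H.
have : {ae (m2 \x m1)%E, forall x, swap2 h x = 0}.
  apply: H; apply: (@le_trans _ _ (ip P (0 \*o h) h)); last by rewrite ipZl// mul0r.
  apply: ae_le_ip => //; first exact: sqintZ.
  by apply: filterS s0 => x s0; rewrite /h/= (min_l s0) !mulr0.
by apply: filterS => x; rewrite /swap2 /h; case: (lerP 0 (s _)) => // s_lt0 s_eq0; lra.
Qed.

(** The mass is a pairing with [\1_D], not an L^1 norm, so that it is linear in [U] and midpoints
    stay admissible. *)
Record admissible d (T : measurableType d) (m : {measure set T -> \bar R})
    (D : set T) (delta mass M : R) (U : T -> R) : Prop := Admissible {
  adm_sqint : sqint m U ;
  adm_supp : supported D U ;
  adm_ge : {ae m, forall x, D x -> delta <= U x} ;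
  adm_mass : ip m U \1_D = mass ;
  adm_nrm : nrm m U <= M }.

Lemma adm_ge0 d (T : measurableType d) (m : {measure set T -> \bar R})
    (D : set T) (delta mass M : R) (U : T -> R) : 0 < delta ->
  admissible m D delta mass M U -> {ae m, forall x, 0 <= U x}.
Proof.
move=> delta0 [_ supp dU _ _]; apply: filterS dU => x dU.
have [Dx|Dx] := pselect (D x); last by rewrite supp.
by rewrite (le_trans (ltW delta0))// dU.
Qed.

Lemma adm_mid d (T : measurableType d) (m : {measure set T -> \bar R})
    (D : set T) (delta mass M : R) (U X : T -> R) :
  measurable D -> (m D < +oo)%E ->
  admissible m D delta mass M U -> admissible m D delta mass M X ->
  admissible m D delta mass M (2^-1 \*o (U \+ X)).
Proof.
move=> mD Dfin [sU suppU dU mU nU] [sX suppX dX mX nX].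
have sUX := sqintD sU sX; have sD := sqint_indic mD Dfin.
split; first exact: sqintZ.
- by move=> x nD /=; rewrite suppU// suppX// addr0 mulr0.
- by apply: filterS2 dU dX => x dU dX Dx /=; have := dU Dx; have := dX Dx; lra.
- by rewrite ipZl// ipDl// mU mX; lra.
- rewrite nrmZ// ger0_norm ?invr_ge0//; have := ler_nrmD sU sX; lra.
Qed.

Section repair.
Variables (gamma delta mass M B clow : R).
Hypotheses (gamma0 : 0 < gamma) (delta0 : 0 < delta) (mass0 : 0 < mass).
Hypotheses (M0 : 0 <= M) (B0 : 0 <= B).

(** With [C = residual_cst], the deficits have norm at most [C t], hence the correction at most
    [(C t)^2 / (t mass)]. In [repair_cst] the first summand pays for the removed mass, at most
    [C t * nrm m1 \1_D1] by Cauchy-Schwarz; the others pay for the correction, in the linear part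
    and then in the cross and square terms of the quadratic part. *)
Definition residual_cst := 2 + M + B / delta.
Definition correction_cst := residual_cst ^+ 2 / mass.
Definition repair_cst := `|clow| * (residual_cst * nrm m1 \1_D1) +
  M * correction_cst +
  gamma / 2 * (2 * (B * correction_cst) + correction_cst ^+ 2).

(** Here [s], with marginals [X] and [Y], is the plan to be repaired for [U] and [V]. In the proof
    [p] is the damped plan and [q] the correction, so the witness is [p + q]. *)
Lemma repair t c s X Y U V : 0 < t -> t <= 1 ->
  sqint P c -> nrm P c <= M ->
  {ae P, forall x, (D1 `*` D2) x -> clow <= c x} ->
  plan X Y s -> nrm P s <= B ->
  admissible m1 D1 delta mass M X -> admissible m2 D2 delta mass M Y ->
  admissible m1 D1 delta mass M U -> admissible m2 D2 delta mass M V ->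
  nrm m1 (X \- U) <= t -> nrm m2 (Y \- V) <= t ->
  exists2 q, plan U V q & cost gamma c q <= cost gamma c s + repair_cst * t.
Proof.
move=> t0 t1 sc cM c_ge [ss supp_s s0 sX_ sY_] sB aX aY aU aV XU YV.
have [sX suppX dX mX nX] := aX; have [sY suppY dY mY nY] := aY.
have [sU suppU dU mU nU] := aU; have [sV suppV dV mV nV] := aV.
have U0 := adm_ge0 delta0 aU; have V0 := adm_ge0 delta0 aV.
have U0' : {ae m1, forall x, D1 x -> 0 <= U x} by apply: filterS U0.
have V0' : {ae m2, forall x, D2 x -> 0 <= V x} by apply: filterS V0.
have [u1 [mu1 u1b u1X u1X' u1d]] := truncated_ratio delta0 sX sU suppX suppU dX U0'.
have [u2 [mu2 u2b u2Y u2Y' u2d]] := truncated_ratio delta0 sY sV suppY suppV dY V0'.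
have snorm d (T : measurableType d) (m : {measure set T -> \bar R}) (F G : T -> R) :
    sqint m F -> sqint m G -> nrm m (F \- G) <= t ->
    sqint m (fun x => delta^-1 * `|F x - G x|) /\
    nrm m (fun x => delta^-1 * `|F x - G x|) <= delta^-1 * t.
  move=> sF sG FGt; have sFG := sqintB sF sG.
  have sn : sqint m (fun x => `|F x - G x|).
    apply: (sqint_le _ sFG); last by move=> x; rewrite normr_id.
    by apply: measurableT_comp => //; case: sFG.
  split; first exact: (sqintZ delta^-1 sn).
  have dV0 : 0 < delta^-1 by rewrite invr_gt0.
  rewrite (nrmZ delta^-1 sn) gtr0_norm// ler_pM2l//; apply: le_trans FGt.
  by apply: ae_le_nrm => //; apply/aeW => x; rewrite normr_id.
have [sv1 v1t] := snorm _ _ _ _ _ sX sU XU.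
have [sv2 v2t] := snorm _ _ _ _ _ sY sV YV.
pose p := damp t s u1 u2.
have [r1 [sr1 suppr1 ip_r1 r1_ge r1_le]] := residual mD1 mD2 D1_fin D2_fin t0 t1
  delta0 ss supp_s s0 sB sX nX sX_ sU suppU U0 XU mu1 u1b mu2 u2b u1X u1X' sv2 v2t u2d.
have ss' := sqint_swap ss.
have supp_s' : supported (D2 `*` D1) (swap2 s).
  by move=> x nD; rewrite /swap2 supp_s// => -[/= ? ?]; exact: nD.
have s0' := ae_swap_ge0 ss s0.
have sB' : nrm (m2 \x m1)%E (swap2 s) <= B by rewrite /nrm ip_swap.
have sY_' psi : sqint m2 psi -> ip (m2 \x m1)%E (swap2 s) (tens psi \1_D1) = ip m2 Y psi.
  move=> spsi; rewrite -sY_// -(swap2_tens \1_D1 psi) ip_swap//; exact: sqint_tens.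
have [r2 [sr2 suppr2 ip_r2' r2_ge r2_le]] := residual mD2 mD1 D2_fin D1_fin t0 t1
  delta0 ss' supp_s' s0' sB' sY nY sY_' sV suppV V0 YV mu2 u2b mu1 u1b u2Y u2Y' sv1 v1t u1d.
have sp : sqint P p by exact: sqint_damp.
have ip_r2 psi : sqint m2 psi -> ip P p (tens \1_D1 psi) = ip m2 V psi - ip m2 r2 psi.
  move=> spsi; rewrite -ip_r2'// -(swap2_tens \1_D1 psi) -ip_swap//; last exact: sqint_tens.
  congr ip; apply/funext => x; rewrite /swap2 /p /damp /tens/=.
  by rewrite [u1 _ * _]mulrC.
have C0 : 0 <= residual_cst by rewrite !addr_ge0// divr_ge0// ltW.
have r1_ge0 : {ae m1, forall x, 0 <= r1 x}.
  by apply: filterS2 r1_ge U0 => x + U0; apply: le_trans; rewrite mulr_ge0// ltW.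
have r2_ge0 : {ae m2, forall x, 0 <= r2 x}.
  by apply: filterS2 r2_ge V0 => x + V0; apply: le_trans; rewrite mulr_ge0// ltW.
pose z := ip m1 r1 \1_D1.
have sDD := sqint_tens sD1 sD2.
have zE : z = mass - ip P p (tens \1_D1 \1_D2) by rewrite ip_r1// mU subKr.
(* Both deficits equal the prescribed mass minus the mass of [p]. This equality is what lets one
   normalization [z^-1] produce both marginals [r1] and [r2]. *)
have z2 : ip m2 r2 \1_D2 = z by rewrite zE ip_r2// mV subKr.
have z_ge : t * mass <= z.
  rewrite -mU -ipZl//; apply: ae_le_ip => //; first exact: sqintZ.
  by apply: filterS r1_ge => x r1x; rewrite ler_wpM2r.
have z0 : 0 < z by apply: lt_le_trans z_ge; rewrite mulr_gt0.
have pq := plan_tens mD1 mD2 D1_fin D2_fin z0 sr1 sr2 suppr1 suppr2 r1_ge0 r2_ge0 erefl z2.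
pose q := z^-1 \*o tens r1 r2.
have [sq suppq q0 qr1 qr2] : plan r1 r2 q := pq.
have w_le1 x : 0 <= (1 - t) * tens u1 u2 x <= 1.
  have /andP[? ?] := u1b x.1; have /andP[? ?] := u2b x.2.
  have t1' : 0 <= 1 - t by rewrite subr_ge0.
  have w0 : 0 <= tens u1 u2 x by rewrite mulr_ge0.
  by rewrite mulr_ge0//= mulr_ile1// ?mulr_ile1// lerBlDr lerDl ltW.
have pE x : p x = s x * ((1 - t) * tens u1 u2 x) by rewrite /p /damp/= mulrCA.
have p0 : {ae P, forall x, 0 <= p x}.
  by apply: filterS s0 => x s0; rewrite pE mulr_ge0//; case/andP: (w_le1 x).
have ps : {ae P, forall x, p x <= s x}.
  by apply: filterS s0 => x s0; rewrite pE ler_piMr//; case/andP: (w_le1 x).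
exists (p \+ q).
  split; first exact: sqintD.
  - by move=> x nD /=; rewrite suppq// pE supp_s// mul0r addr0.
  - by apply: filterS2 p0 q0 => x p0 q0 /=; rewrite addr_ge0.
  - move=> phi sphi; rewrite ipDl//; last exact: sqint_tens.
    by rewrite qr1// ip_r1// subrK.
  - move=> psi spsi; rewrite ipDl//; last exact: sqint_tens.
    by rewrite qr2// ip_r2// subrK.
have Q0 : 0 <= correction_cst by rewrite divr_ge0 ?sqr_ge0// ltW.
have sub_t : t ^+ 2 <= t by rewrite expr2 ler_piMl// ltW.
have q_le : nrm P q <= correction_cst * t.
  rewrite nrmZ; last exact: sqint_tens.
  rewrite nrm_tens// gtr0_norm ?invr_gt0// mulrC ler_pdivrMr//.
  have -> : correction_cst = residual_cst * residual_cst / mass by rewrite /correction_cst expr2.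
  apply: (@le_trans _ _ (residual_cst * t * (residual_cst * t))).
    by rewrite ler_pM ?nrm_ge0.
  (* Write [(C t)^2] as [(C^2 / mass * t) * (t * mass)] and use [t * mass <= z]. *)
  have tm0 : 0 <= residual_cst * residual_cst / mass * t.
    by rewrite !mulr_ge0 ?invr_ge0// ltW.
  apply: le_trans (ler_wpM2l tm0 z_ge).
  by rewrite le_eqVlt; apply/orP; left; apply/eqP; field; rewrite gt_eqF.
have p_le : nrm P p <= B.
  apply: le_trans sB; apply: ae_le_nrm => //.
  by apply: filterS2 p0 ps => x p0 ps; rewrite !ger0_norm// (le_trans p0).
have pp_le : ip P p p <= ip P s s.
  apply: ae_le_ip => //; apply: filterS2 p0 ps => x p0 ps.
  by rewrite ler_pM.
have cp_le : ip P c p <= ip P c s + `|clow| * (residual_cst * nrm m1 \1_D1) * t.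
  have spB := sqintB ss sp.
  have H : - (`|clow|) * ip P (tens \1_D1 \1_D2) (s \- p) <= ip P c (s \- p).
    rewrite -ipZl//; apply: ae_le_ip => //; first exact: sqintZ.
    apply: filterS2 c_ge ps => x cx px /=.
    have [Dx|nD] := pselect ((D1 `*` D2) x); last first.
      by rewrite pE supp_s// mul0r subrr !mulr0.
    rewrite ler_wpM2r ?subr_ge0// /tens !indicE !mem_set ?mulr1; [|by case: Dx..].
    by rewrite (le_trans _ (cx Dx))// lerNl (le_trans (ler_norm _))// normrN.
  have -> : ip P c p = ip P c s - ip P c (s \- p) by rewrite ipBr// subKr.
  (* [X] and [U] have equal mass, so the mass removed from [s] is that of the deficit. *)
  have zB : ip P (tens \1_D1 \1_D2) (s \- p) = z.
    by rewrite ipBr// ipC sX_// mX (ipC _ _ p) zE.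
  have zle : z <= residual_cst * nrm m1 \1_D1 * t.
    rewrite mulrAC; apply: le_trans (cauchy_schwarz sr1 sD1) _.
    by rewrite ler_wpM2r ?nrm_ge0.
  rewrite zB in H; have := ler_wpM2l (normr_ge0 clow) zle; lra.
have cq_le : ip P c q <= M * correction_cst * t.
  by rewrite (le_trans (cauchy_schwarz sc sq))// -mulrA ler_pM ?nrm_ge0.
have pq_le : ip P p q <= B * correction_cst * t.
  by rewrite (le_trans (cauchy_schwarz sp sq))// -mulrA ler_pM ?nrm_ge0.
have qq_le : ip P q q <= correction_cst ^+ 2 * t.
  rewrite -sqr_nrm; apply: (@le_trans _ _ ((correction_cst * t) ^+ 2)).
    by rewrite lerXn2r// nnegrE ?nrm_ge0// mulr_ge0// ltW.
  by rewrite exprMn ler_wpM2l// sqr_ge0.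
have sqp := sqintD sp sq.
rewrite /cost ipDr// ipDr// !ipDl// (ipC _ q p).
rewrite [leRHS](_ : _ = (ip P c s + `|clow| * (residual_cst * nrm m1 \1_D1) * t) +
  (M * correction_cst * t) + gamma / 2 * (ip P s s + B * correction_cst * t +
  (B * correction_cst * t + correction_cst ^+ 2 * t))); last first.
  by rewrite /repair_cst; field.
apply: lerD; first exact: lerD.
have g2 : 0 < gamma / 2 by rewrite divr_gt0.
by rewrite (ler_pM2l g2); do 2 (apply: lerD => //); exact: lerD.
Qed.

End repair.

(** * A priori bound and Hoelder estimate for minimizers *)

Section hoelder_stability.
Variables (gamma delta mass M clow : R).
Hypotheses (gamma0 : 0 < gamma) (delta0 : 0 < delta) (mass0 : 0 < mass).
Hypothesis (M0 : 0 <= M).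

Definition minimizer c U V s :=
  plan U V s /\ forall q, plan U V q -> cost gamma c s <= cost gamma c q.

(** Comparison with the product plan, of norm at most [Q = M ^+ 2 / mass], gives [gamma / 2 * x^2 <=
    M x + M Q + gamma / 2 * Q^2] for the norm [x] of a minimizer. If [x > 1], the constant terms are
    at most themselves times [x], and one factor [x] cancels; the summand [1] covers [x <= 1]. *)
Definition plan_bound := 1 + 2 / gamma *
  (M + M * (M ^+ 2 / mass) + gamma / 2 * (M ^+ 2 / mass) ^+ 2).

Lemma plan_bound_ge1 : 1 <= plan_bound.
Proof.
rewrite /plan_bound lerDl mulr_ge0// ?divr_ge0// ?(ltW gamma0)//.
have m0 : 0 <= M ^+ 2 / mass by rewrite divr_ge0 ?sqr_ge0// ltW.
by rewrite !addr_ge0// mulr_ge0// ?sqr_ge0// divr_ge0// ltW.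
Qed.

Lemma plan_admissible U V : admissible m1 D1 delta mass M U ->
  admissible m2 D2 delta mass M V -> plan U V (mass^-1 \*o tens U V).
Proof.
move=> aU aV; have U0 := adm_ge0 delta0 aU; have V0 := adm_ge0 delta0 aV.
by case: aU aV => ? ? ? ? ? [*]; exact: plan_tens.
Qed.

Lemma minimizer_bound c U V s : sqint P c -> nrm P c <= M ->
  admissible m1 D1 delta mass M U -> admissible m2 D2 delta mass M V ->
  minimizer c U V s -> nrm P s <= plan_bound.
Proof.
move=> sc cM aU aV [[ss _ _ _ _] smin].
have pq := plan_admissible aU aV; have /smin := pq; set q := _ \*o _.
have [sU _ _ _ nU] := aU; have [sV _ _ _ nV] := aV.
have sq : sqint P q by case: pq.
set Q := M ^+ 2 / mass.
have m0 : 0 <= Q by rewrite divr_ge0 ?sqr_ge0// ltW.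
have q_le : nrm P q <= Q.
  rewrite nrmZ; last exact: sqint_tens.
  rewrite nrm_tens// gtr0_norm ?invr_gt0// mulrC /Q expr2 ler_wpM2r ?invr_ge0 ?(ltW mass0)//.
  by rewrite ler_pM ?nrm_ge0.
have qq : ip P q q <= Q ^+ 2 by rewrite -sqr_nrm lerXn2r ?nnegrE ?nrm_ge0.
have cq : ip P c q <= M * Q by rewrite (le_trans (cauchy_schwarz sc sq))// ler_pM ?nrm_ge0.
have cs : - (M * nrm P s) <= ip P c s.
  rewrite lerNl; apply: le_trans (ler_norm _) _; rewrite normrN.
  by rewrite (le_trans (le_ip_nrmM sc ss))// ler_wpM2r ?nrm_ge0.
rewrite /cost -(sqr_nrm _ s) => sq_le.
have g2 : 0 < gamma / 2 by rewrite divr_gt0.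
have gqq := ler_wpM2l (ltW g2) qq.
have [s1|s1] := leP (nrm P s) 1; first by rewrite (le_trans s1)// plan_bound_ge1.
set A := M + M * Q + gamma / 2 * Q ^+ 2.
have A0 : 0 <= M * Q + gamma / 2 * Q ^+ 2.
  by rewrite addr_ge0// mulr_ge0// ?sqr_ge0// ltW.
have H : gamma / 2 * nrm P s ^+ 2 <= A * nrm P s.
  have : M * Q + gamma / 2 * Q ^+ 2 <= (M * Q + gamma / 2 * Q ^+ 2) * nrm P s.
    by rewrite ler_peMr// ltW.
  rewrite /A; lra.
have s0 : 0 < nrm P s by exact: lt_trans s1.
move: H; rewrite expr2 mulrA ler_pM2r// => H.
rewrite /plan_bound -/Q -/A; apply: (@le_trans _ _ (2 / gamma * A)); last by lra.
have -> : nrm P s = 2 / gamma * (gamma / 2 * nrm P s) by field; rewrite gt_eqF.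
by rewrite ler_wpM2l// divr_ge0// ltW.
Qed.

(** Adding the two comparisons yields [gamma / 4] times the squared distance on one side. On the
    other stand two repair losses and half of the cross term [ip P (c \- c') (s' \- s)], which is at
    most [2 * plan_bound * t]. *)
Definition stability_cst := 4 / gamma *
  (2 * `|repair_cst gamma delta mass M plan_bound clow| + plan_bound).

(* Comparing both minimizers, through repaired plans, with their midpoint turns
   the strong convexity of the cost into a bound on their distance. *)
Lemma minimizer_stable t c c' U U' V V' s s' : 0 < t -> t <= 1 ->
  sqint P c -> nrm P c <= M -> sqint P c' -> nrm P c' <= M ->
  {ae P, forall x, (D1 `*` D2) x -> clow <= c x} ->
  {ae P, forall x, (D1 `*` D2) x -> clow <= c' x} ->
  admissible m1 D1 delta mass M U -> admissible m2 D2 delta mass M V ->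
  admissible m1 D1 delta mass M U' -> admissible m2 D2 delta mass M V' ->
  minimizer c U V s -> minimizer c' U' V' s' ->
  nrm P (c \- c') <= t -> nrm m1 (U \- U') <= t -> nrm m2 (V \- V') <= t ->
  nrm P (s \- s') ^+ 2 <= stability_cst * t.
Proof.
move=> t0 t1 sc cM sc' cM' c_ge c_ge' aU aV aU' aV' mins mins' cc UU VV.
have sB := minimizer_bound sc cM aU aV mins.
have sB' := minimizer_bound sc' cM' aU' aV' mins'.
have [ps smin] := mins; have [ps' smin'] := mins'.
have [ss _ _ _ _] := ps; have [ss' _ _ _ _] := ps'.
have sU := adm_sqint aU; have sV := adm_sqint aV.
have sU' := adm_sqint aU'; have sV' := adm_sqint aV'.
have pm := plan_mid mD1 mD2 D1_fin D2_fin ps ps' sU sU' sV sV'.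
have aX := adm_mid mD1 D1_fin aU aU'; have aY := adm_mid mD2 D2_fin aV aV'.
have smB : nrm P (2^-1 \*o (s \+ s')) <= plan_bound.
  rewrite nrmZ; last exact: sqintD.
  by rewrite ger0_norm ?invr_ge0//; have := ler_nrmD ss ss'; lra.
have B1 := plan_bound_ge1; have B0 : 0 <= plan_bound by apply: le_trans B1.
(* The mean marginals are as close to either pair as the two pairs are to each other. *)
have mid_dist d (T : measurableType d) (m : {measure set T -> \bar R}) (F G : T -> R) :
    sqint m F -> sqint m G -> nrm m (F \- G) <= t ->
    nrm m ((2^-1 \*o (F \+ G)) \- F) <= t /\ nrm m ((2^-1 \*o (F \+ G)) \- G) <= t.
  move=> sF sG FGt; have sFG := sqintB sF sG; have sZ := sqintZ (2^-1) (sqintD sF sG).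
  by split; apply: le_trans FGt; apply: ae_le_nrm => //; try exact: sqintB;
    apply/aeW => x /=; have := ler_norm (F x - G x);
    have := ler_norm (- (F x - G x)); rewrite normrN => ? ?; rewrite ler_norml;
    apply/andP; split; lra.
have [XU XU'] := mid_dist _ _ _ _ _ sU sU' UU.
have [YV YV'] := mid_dist _ _ _ _ _ sV sV' VV.
set K := repair_cst gamma delta mass M plan_bound clow.
have [q pq qle] := repair gamma0 delta0 mass0 M0 B0 t0 t1 sc cM c_ge pm smB aX aY aU aV XU YV.
have [q' pq' qle'] := repair gamma0 delta0 mass0 M0 B0 t0 t1 sc' cM' c_ge' pm smB
  aX aY aU' aV' XU' YV'.
have := le_trans (smin _ pq) qle; have := le_trans (smin' _ pq') qle'.
rewrite -/K !cost_mid//.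
have H1 : K * t <= `|K| * t by rewrite ler_wpM2r ?ler_norm// ltW.
have sBB := sqintB ss ss'; have scc := sqintB sc sc'.
(* What remains of the linear parts when the midpoint costs for [c] and [c'] are added. *)
have H2 : ip P (c \- c') (s' \- s) <= t * (2 * plan_bound).
  apply: le_trans (cauchy_schwarz _ _) _ => //; first exact: sqintB.
  rewrite ler_pM ?nrm_ge0//; apply: le_trans (ler_nrmB ss' ss) _; lra.
rewrite ipBr// !ipBl// in H2.
rewrite /cost sqr_nrm => H3 H4.
rewrite /stability_cst -/K.
have g4 : 0 < gamma / 4 by rewrite divr_gt0.
rewrite -(ler_pM2l g4) [leRHS](_ : _ = (2 * `|K| + plan_bound) * t); last first.
  by field; rewrite gt_eqF.
lra.
Qed.

(** The root of the preceding estimate, freed of [0 < t <= 1]. The two summands of the witness for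
    [L] serve [h >= 1], where the a priori bound suffices, and [h < 1]. *)
Lemma minimizer_hoelder : exists2 L : R, 0 < L &
  forall h c c' U U' V V' s s', 0 <= h ->
  sqint P c -> nrm P c <= M -> sqint P c' -> nrm P c' <= M ->
  {ae P, forall x, (D1 `*` D2) x -> clow <= c x} ->
  {ae P, forall x, (D1 `*` D2) x -> clow <= c' x} ->
  admissible m1 D1 delta mass M U -> admissible m2 D2 delta mass M V ->
  admissible m1 D1 delta mass M U' -> admissible m2 D2 delta mass M V' ->
  minimizer c U V s -> minimizer c' U' V' s' ->
  nrm P (c \- c') <= h -> nrm m1 (U \- U') <= h -> nrm m2 (V \- V') <= h ->
  nrm P (s \- s') <= L * Num.sqrt h.
Proof.
have B1 := plan_bound_ge1; have B0 : 0 <= plan_bound by apply: le_trans B1.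
have S0 : 0 <= stability_cst.
  by rewrite mulr_ge0 ?divr_ge0 ?(ltW gamma0)// addr_ge0// mulr_ge0.
have L0 : 0 <= Num.sqrt stability_cst by exact: sqrtr_ge0.
exists (2 * plan_bound + Num.sqrt stability_cst); first by lra.
move=> h c c' U U' V V' s s' h0 sc cM sc' cM' cg cg' aU aV aU' aV' ms ms' cc UU VV.
have [h1|h1] := leP 1 h.
  have sh1 : 1 <= Num.sqrt h by rewrite -(sqrtr1 R) ler_wsqrtr.
  have sB := minimizer_bound sc cM aU aV ms.
  have sB' := minimizer_bound sc' cM' aU' aV' ms'.
  have [[ss _ _ _ _] _] := ms; have [[ss' _ _ _ _] _] := ms'.
  have := ler_nrmB ss ss' => H; apply: (@le_trans _ _ (2 * plan_bound)); first by lra.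
  by nra.
have H t : 0 < t -> t <= 1 -> h <= t -> nrm P (s \- s') ^+ 2 <= stability_cst * t.
  by move=> t0 t1 ht; apply: (minimizer_stable t0 t1 sc cM sc' cM' cg cg' aU aV aU' aV' ms ms');
    apply: le_trans ht.
have {H} : nrm P (s \- s') ^+ 2 <= stability_cst * h.
  move: h0; rewrite le_eqVlt => /predU1P[h0|h0]; last by apply: H => //; exact: ltW.
  (* Damping needs [t > 0]; for [h = 0] take [t = 2^-1 ^+ n] and let [n] grow. *)
  apply: (@ler_geometric _ _ _ stability_cst) => n; rewrite -h0 mulr0 add0r.
  apply: H; rewrite ?exprn_gt0 ?invr_gt0// -?h0 ?exprn_ge0 ?invr_ge0//.
  by rewrite exprn_ile1// ?invr_ge0//; lra.
move=> H; have : nrm P (s \- s') <= Num.sqrt stability_cst * Num.sqrt h.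
  rewrite -sqrtrM// -[leLHS]ger0_norm ?nrm_ge0// -sqrtr_sqr.
  exact: ler_wsqrtr.
have := sqrtr_ge0 h; nra.
Qed.

End hoelder_stability.

End stability.

(** * Transport on compact sets *)

Section L2_translation.
Context d (T : measurableType d) (R : realType) (mu : {measure set T -> \bar R}).
Variable D : set T.
Implicit Types f g : T -> R.

Lemma supported_patch f : supported D (f \_ D).
Proof. by move=> x Dx; rewrite patchE memNset. Qed.

Lemma patch_supported f : supported D f -> f \_ D = f.
Proof.
move=> suppf; apply/funext => x; rewrite patchE.
by case: (boolP (x \in D)) => // /negP xD; rewrite suppf// => /mem_set.
Qed.

Lemma patch_subr f g : (f \- g) \_ D = (f \_ D) \- (g \_ D).
Proof. by apply/funext => x; rewrite /= !patchE; case: ifP; rewrite ?subr0. Qed.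

Lemma L2P f : L2 mu D f <-> sqint mu (f \_ D).
Proof.
split=> [|[mf sf]].
  rewrite /L2/= => fL; split; last exact: Lfun2_integrable_sqr.
  by move: fL; rewrite inE => /andP[+ _]; rewrite inE.
rewrite /L2/= inE; apply/andP; split; rewrite inE//= /finite_norm unlock /Lnorm.
rewrite poweR_lty//; have [_] := integrableP _ _ _ sf.
apply: le_lt_trans; rewrite le_eqVlt; apply/orP; left; apply/eqP.
apply: eq_integral => x _ /=; congr EFin; rewrite [RHS]ger0_norm ?sqr_ge0//.
by rewrite powR_mulrn// real_normK ?num_real.
Qed.

Lemma normL2E f : L2 mu D f -> normL mu D 2%:E f = (nrm mu (f \_ D))%:E.
Proof.
move=> /L2P sf; rewrite /normL unlock /Lnorm.
rewrite (eq_integral (fun x => ((f \_ D) x * (f \_ D) x)%:E)); last first.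
  by move=> x _ /=; rewrite powR_mulrn// real_normK ?num_real// expr2.
by rewrite ereal_ipE// poweR_EFin powR12_sqrt// ipxx_ge0.
Qed.

Lemma sqr_normL2E f : L2 mu D f ->
  (normL mu D 2%:E f `^ 2 = (ip mu (f \_ D) (f \_ D))%:E)%E.
Proof.
by move=> fL; rewrite normL2E// poweR_EFin powR_mulrn ?nrm_ge0// sqr_nrm.
Qed.

Lemma normL1E f (delta mass : R) : measurable D -> (mu D < +oo)%E ->
  0 < delta -> L2 mu D f ->
  {ae mu, forall x, D x -> delta <= f x} ->
  normL mu D 1 f = mass%:E -> ip mu (f \_ D) \1_D = mass.
Proof.
move=> mD Dfin delta0 /L2P sf fd; rewrite /normL Lnorm1 => fm.
have sD := sqint_indic mD Dfin.
apply: EFin_inj; rewrite -fm -ereal_ipE//; have [mf _] := sf.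
apply: ae_eq_integral => //.
- by apply/measurable_EFinP; apply: measurable_funM => //; exact: measurable_indic.
- by apply: measurableT_comp => //; exact/measurable_EFinP.
- apply: filterS fd => x fd _ /=; congr EFin.
  rewrite patchE indicE; case: (boolP (x \in D)) => [/set_mem Dx|_].
    by rewrite mulr1 ger0_norm// (le_trans (ltW delta0))// fd.
  by rewrite mul0r normr0.
Qed.

Lemma ae_ge_patch f (k : R) : {ae mu, forall x, D x -> k <= f x} ->
  {ae mu, forall x, D x -> k <= (f \_ D) x}.
Proof. by apply: filterS => x kf Dx; rewrite patchE mem_set// kf. Qed.

End L2_translation.

(** * Compact sets are measurable and of finite Lebesgue measure *)

Section compact_rV.
Variables (R : realType).

Lemma compact_measurable_rV n (A : set 'rV[R]_n) : compact A -> measurable A.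
Proof.
move=> cA; rewrite -(setCK A); apply: measurableC.
apply: measurable_open_rV; apply: closed_openC.
by apply: compact_closed => //; exact: norm_hausdorff.
Qed.

Lemma compact_lebesgue_rV_lty n (A : set 'rV[R]_n) : compact A ->
  (lebesgue_rV R n A < +oo)%E.
Proof.
move=> cA; have [M [_ AM]] := compact_bounded cA.
(* The bound on norms is available for every real strictly above [M]. *)
pose K : R := `|M| + 1.
have AK x i : A x -> x ord0 i \in `[(- K), K].
  move=> Ax; have := AM K; rewrite /K ltr_pwDr ?ler_norm// => /(_ isT x Ax) /= xK.
  rewrite in_itv/= -ler_norml (le_trans _ xK)// [leRHS]/Num.norm/= mx_normrE.
  by apply/bigmax_geP; right => /=; exists (ord0, i).
have mK : measurable [set` `[(- K), K]] by exact: measurable_itv.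
pose F (i : 'I_n) : set R := [set` `[(- K), K]].
have mF i : measurable (F i) by exact: mK.
apply: (@le_lt_trans _ _ (lebesgue_rV R n [set x | forall i, F i (x ord0 i)])).
  apply: le_measure; rewrite ?inE.
  - exact: compact_measurable_rV.
  - rewrite [X in measurable X](_ : _ =
        \bigcap_(i in [set: 'I_n]) (fun x : 'rV[R]_n => x ord0 i) @^-1` F i).
      apply: fin_bigcap_measurable => // i _.
      by rewrite -[X in measurable X]setTI; exact: measurable_coord_rV.
    by apply/seteqP; split=> x /= Fx i; [move=> _|]; exact: Fx.
  - by move=> x Ax i /=; exact: AK.
rewrite lebesgue_rV_box//.
suff /andP[] : (0 <= \prod_(i < n) lebesgue_measure (F i) < +oo)%E by [].
elim/big_ind : _ => [|x y /andP[x0 xoo] /andP[y0 yoo]|i _]; first by rewrite lee01 ltry.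
  by rewrite mule_ge0//= lte_mul_pinfty// ge0_fin_numE.
by rewrite measure_ge0 /F lebesgue_measure_itv/=; case: ifP => _; rewrite -?EFinB ltry.
Qed.

End compact_rV.

(** * From the transport problem on the domain to the weak formulation *)

Section transport_translation.
Variables (R : realType) (d1 d2 : nat).
Variables (Omega1 : set 'rV[R]_d1) (Omega2 : set 'rV[R]_d2).
Local Notation lam1 := (lebesgue_rV R d1).
Local Notation lam2 := (lebesgue_rV R d2).
Local Notation lam := (lam1 \x lam2)%E.
Local Notation Omega := (Omega1 `*` Omega2).
Hypotheses (mO1 : measurable Omega1) (mO2 : measurable Omega2).
Hypotheses (O1_fin : (lam1 Omega1 < +oo)%E) (O2_fin : (lam2 Omega2 < +oo)%E).
Implicit Types (c p q : 'rV[R]_d1 * 'rV[R]_d2 -> R).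
Implicit Types (U : 'rV[R]_d1 -> R) (V : 'rV[R]_d2 -> R).

Lemma integral_slice1 U p x :
  (\int[lam2]_y ((p \_ Omega) (x, y))%:E = ((U \_ Omega1) x)%:E)%E <->
  (Omega1 x -> \int[lam2]_(y in Omega2) (p (x, y))%:E = (U x)%:E)%E.
Proof.
have [Ox|Ox] := pselect (Omega1 x); last first.
  split=> // _; rewrite patchE memNset// integral0_eq// => y _.
  by rewrite patchE memNset// => -[].
rewrite patchE mem_set// [in X in _ <-> X]integral_mkcond.
rewrite (_ : (fun y => _) = (fun y => (p (x, y))%:E) \_ Omega2).
  by split=> // /(_ Ox).
apply/funext => y; rewrite !patchE; have [Oy|Oy] := pselect (Omega2 y).
  by rewrite !mem_set.
by rewrite !memNset// => -[].
Qed.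

Lemma integral_slice2 V p y :
  (\int[lam1]_x ((p \_ Omega) (x, y))%:E = ((V \_ Omega2) y)%:E)%E <->
  (Omega2 y -> \int[lam1]_(x in Omega1) (p (x, y))%:E = (V y)%:E)%E.
Proof.
have [Oy|Oy] := pselect (Omega2 y); last first.
  split=> // _; rewrite patchE memNset// integral0_eq// => x _.
  by rewrite patchE memNset// => -[].
rewrite patchE mem_set// [in X in _ <-> X]integral_mkcond.
rewrite (_ : (fun x => _) = (fun x => (p (x, y))%:E) \_ Omega1).
  by split=> // /(_ Oy).
apply/funext => x; rewrite !patchE; have [Ox|Ox] := pselect (Omega1 x).
  by rewrite !mem_set.
by rewrite !memNset// => -[].
Qed.

(** After extension by zero both sides of a marginal equation vanish off the domain, so it may be
    imposed on the whole space; [marginal_weakP] then applies, after [swap2] for the second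
    marginal. *)
Lemma plansP U V p : sqint lam1 (U \_ Omega1) -> sqint lam2 (V \_ Omega2) ->
  plans Omega1 Omega2 U V p <->
  plan lam1 lam2 Omega1 Omega2 (U \_ Omega1) (V \_ Omega2) (p \_ Omega).
Proof.
move=> sU sV.
have ae1 : {ae lam1, forall x, (Omega1 x ->
      \int[lam2]_(y in Omega2) (p (x, y))%:E = (U x)%:E)%E} <->
    {ae lam1, forall x, (\int[lam2]_y ((p \_ Omega) (x, y))%:E = ((U \_ Omega1) x)%:E)%E}.
  by split; apply: filterS => x /integral_slice1.
have ae2 : {ae lam2, forall y, (Omega2 y ->
      \int[lam1]_(x in Omega1) (p (x, y))%:E = (V y)%:E)%E} <->
    {ae lam2, forall y, (\int[lam1]_x ((p \_ Omega) (x, y))%:E = ((V \_ Omega2) y)%:E)%E}.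
  by split; apply: filterS => y /integral_slice2.
have suppp : supported Omega (p \_ Omega) by exact: supported_patch.
have ge0E : {ae lam, forall x, Omega x -> 0 <= p x} <->
    {ae lam, forall x, 0 <= (p \_ Omega) x}.
  split; apply: filterS => x.
    by move=> px; rewrite patchE; case: (boolP (x \in Omega)) => // /set_mem /px.
  by move=> + Ox; rewrite patchE mem_set.
have swap_ip (sp : sqint lam (p \_ Omega)) psi : sqint lam2 psi ->
    ip (lam2 \x lam1)%E (swap2 (p \_ Omega)) (tens psi \1_Omega1) =
    ip lam (p \_ Omega) (tens \1_Omega1 psi).
  move=> spsi; rewrite -(swap2_tens \1_Omega1 psi) ip_swap//; apply: sqint_tens => //.
  exact: sqint_indic.
have suppw : supported (Omega2 `*` Omega1) (swap2 (p \_ Omega)).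
  by move=> x nO; rewrite /swap2 suppp// => -[/= ? ?]; exact: nO.
split=> [[/L2P sp /ge0E p0 /ae1 pU /ae2 pV]|[sp _ /ge0E p0 pU pV]].
- split => //.
    exact: (marginal_weakP mO1 mO2 O1_fin O2_fin sp suppp sU).1.
  move=> psi spsi; rewrite -swap_ip//.
  exact: ((marginal_weakP mO2 mO1 O2_fin O1_fin (sqint_swap sp) suppw sV).1 pV).
- split => //; first exact/L2P.
    exact/ae1/(marginal_weakP mO1 mO2 O1_fin O2_fin sp suppp sU).2.
  apply/ae2/(marginal_weakP mO2 mO1 O2_fin O1_fin (sqint_swap sp) suppw sV).2.
  by move=> psi spsi; rewrite swap_ip// pV.
Qed.

Lemma objectiveE (gamma : R) c p : L2 lam Omega c -> L2 lam Omega p ->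
  objective Omega1 Omega2 gamma c p =
  (cost lam1 lam2 gamma (c \_ Omega) (p \_ Omega))%:E.
Proof.
move=> cL pL; rewrite /objective sqr_normL2E// /cost EFinD EFinM; congr (_ + _)%E.
have /L2P sc := cL; have /L2P sp := pL; rewrite -ereal_ipE// [LHS]integral_mkcond.
apply: eq_integral => x _; rewrite !patchE; case: ifP => //.
by rewrite mul0r.
Qed.

(** The competitors correspond: a [plan] vanishes off [Omega], hence is its own extension by
    zero. *)
Lemma is_optimalP (gamma : R) c U V p : L2 lam Omega c ->
  sqint lam1 (U \_ Omega1) -> sqint lam2 (V \_ Omega2) ->
  is_optimal Omega1 Omega2 gamma c U V p <->
  minimizer lam1 lam2 Omega1 Omega2 gamma (c \_ Omega)
    (U \_ Omega1) (V \_ Omega2) (p \_ Omega).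
Proof.
move=> cL sU sV; split=> [[pp pmin]|[pp pmin]].
- have pL : L2 lam Omega p by case: pp.
  split; first exact/plansP.
  move=> q pq; have [sq suppq _ _ _] := pq.
  have qE := patch_supported suppq; have /plansP qplans : plan lam1 lam2 Omega1 Omega2
    (U \_ Omega1) (V \_ Omega2) (q \_ Omega) by rewrite qE.
  have /pmin := qplans sU sV; rewrite !objectiveE ?qE ?lee_fin//.
  by apply/L2P; rewrite qE.
- have pL : L2 lam Omega p by apply/L2P; case: pp.
  split; first exact/plansP.
  move=> q /plansP-/(_ sU sV) pq; have qL : L2 lam Omega q by apply/L2P; case: pq.
  by rewrite !objectiveE// lee_fin; exact: pmin.
Qed.

Lemma normHE c U V : L2 lam Omega c -> L2 lam1 Omega1 U -> L2 lam2 Omega2 V ->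
  normH Omega1 Omega2 c U V =
  (Num.sqrt (nrm lam (c \_ Omega) ^+ 2 + nrm lam1 (U \_ Omega1) ^+ 2 +
             nrm lam2 (V \_ Omega2) ^+ 2))%:E.
Proof.
move=> cL UL VL; rewrite /normH !sqr_normL2E// -!sqr_nrm -!EFinD poweR_EFin.
by rewrite powR12_sqrt// !addr_ge0// sqr_ge0.
Qed.

Lemma marginals_admissible (delta m M : R) U V : 0 < delta ->
  marginals Omega1 Omega2 delta m (U, V) ->
  nrm lam1 (U \_ Omega1) <= M -> nrm lam2 (V \_ Omega2) <= M ->
  admissible lam1 Omega1 delta m M (U \_ Omega1) /\
  admissible lam2 Omega2 delta m M (V \_ Omega2).
Proof.
move=> d0 [/= UL VL [mU mV] dU dV] UM VM; split; split => //.
- exact/L2P.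
- exact: supported_patch.
- exact: ae_ge_patch.
- exact: (normL1E mO1 O1_fin d0).
- exact/L2P.
- exact: supported_patch.
- exact: ae_ge_patch.
- exact: (normL1E mO2 O2_fin d0).
Qed.

End transport_translation.

Lemma ler_sqrt_sum3 (R : rcfType) (a b c : R) : 0 <= a -> 0 <= b -> 0 <= c ->
  [/\ a <= Num.sqrt (a ^+ 2 + b ^+ 2 + c ^+ 2),
      b <= Num.sqrt (a ^+ 2 + b ^+ 2 + c ^+ 2) &
      c <= Num.sqrt (a ^+ 2 + b ^+ 2 + c ^+ 2)].
Proof.
move=> a0 b0 c0.
have H x : 0 <= x -> x ^+ 2 <= a ^+ 2 + b ^+ 2 + c ^+ 2 ->
    x <= Num.sqrt (a ^+ 2 + b ^+ 2 + c ^+ 2).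
  by move=> x0 xs; rewrite -[leLHS]ger0_norm// -sqrtr_sqr ler_wsqrtr.
have := sqr_ge0 a; have := sqr_ge0 b; have := sqr_ge0 c => *.
by split; apply: H => //; lra.
Qed.

Theorem proposition4p6 (R : realType) (d1 d2 : nat)
  (Omega1 : set 'rV[R]_d1) (Omega2 : set 'rV[R]_d2)
  (d1_gt0 : (0 < d1)%N) (d2_gt0 : (0 < d2)%N)
  (compact1 : compact Omega1) (compact2 : compact Omega2)
  (connected1 : connected Omega1) (connected2 : connected Omega2)
  (interior1 : Omega1° !=set0) (interior2 : Omega2° !=set0)
  (regular : closure (prod_rV Omega1 Omega2)° = prod_rV Omega1 Omega2)
  (lipschitz : lipschitz_boundary (prod_rV Omega1 Omega2))
  (gamma delta m clow : R)
  (gamma_gt0 : 0 < gamma) (delta_gt0 : 0 < delta) (m_gt0 : 0 < m) :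
  forall M : R, 0 < M -> exists L : R, 0 < L /\
    forall (cmu cnu : 'rV[R]_d1 * 'rV[R]_d2 -> R)
           (mu1 nu1 : 'rV[R]_d1 -> R) (mu2 nu2 : 'rV[R]_d2 -> R),
      costs Omega1 Omega2 clow cmu ->
      marginals Omega1 Omega2 delta m (mu1, mu2) ->
      costs Omega1 Omega2 clow cnu ->
      marginals Omega1 Omega2 delta m (nu1, nu2) ->
      (normH Omega1 Omega2 cmu mu1 mu2 <= M%:E)%E ->
      (normH Omega1 Omega2 cnu nu1 nu2 <= M%:E)%E ->
      (normL (lebesgue_rV R d1 \x lebesgue_rV R d2) (Omega1 `*` Omega2) 2%:E
         (solution_op Omega1 Omega2 gamma cmu mu1 mu2 \-
          solution_op Omega1 Omega2 gamma cnu nu1 nu2)%R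
       <= L%:E *
          normH Omega1 Omega2 (cmu \- cnu)%R (mu1 \- nu1)%R (mu2 \- nu2)%R `^ 2^-1)%E.
Proof.
move=> M M_gt0.
have mO1 := compact_measurable_rV compact1; have mO2 := compact_measurable_rV compact2.
have O1_fin := compact_lebesgue_rV_lty compact1; have O2_fin := compact_lebesgue_rV_lty compact2.
have [L L0 Lip] := minimizer_hoelder mO1 mO2 O1_fin O2_fin clow gamma_gt0 delta_gt0 m_gt0
  (ltW M_gt0).
exists L; split => // cmu cnu mu1 nu1 mu2 nu2 [cmuL cmu_ge] margmu [cnuL cnu_ge] margnu.
have [/= mu1L mu2L _ _ _] := margmu; have [/= nu1L nu2L _ _ _] := margnu.
rewrite !normHE//; last 3 first.
- by apply/L2P; rewrite patch_subr; apply: sqintB; exact/L2P.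
- by apply/L2P; rewrite patch_subr; apply: sqintB; exact/L2P.
- by apply/L2P; rewrite patch_subr; apply: sqintB; exact/L2P.
rewrite !lee_fin => muM nuM.
have [cmuM mu1M mu2M] := ler_sqrt_sum3 
  (nrm_ge0 (lebesgue_rV R d1 \x lebesgue_rV R d2)%E (cmu \_ (Omega1 `*` Omega2)))
  (nrm_ge0 (lebesgue_rV R d1) (mu1 \_ Omega1)) (nrm_ge0 (lebesgue_rV R d2) (mu2 \_ Omega2)).
have [cnuM nu1M nu2M] := ler_sqrt_sum3 
  (nrm_ge0 (lebesgue_rV R d1 \x lebesgue_rV R d2)%E (cnu \_ (Omega1 `*` Omega2)))
  (nrm_ge0 (lebesgue_rV R d1) (nu1 \_ Omega1)) (nrm_ge0 (lebesgue_rV R d2) (nu2 \_ Omega2)).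
have [amu1 amu2] := marginals_admissible mO1 mO2 O1_fin O2_fin delta_gt0 margmu
  (le_trans mu1M muM) (le_trans mu2M muM).
have [anu1 anu2] := marginals_admissible mO1 mO2 O1_fin O2_fin delta_gt0 margnu
  (le_trans nu1M nuM) (le_trans nu2M nuM).
(* Existence guarantees that [get] returns a minimizer and not a default value. *)
have solutionP c U V : L2 (lebesgue_rV R d1 \x lebesgue_rV R d2)%E (Omega1 `*` Omega2) c ->
    admissible (lebesgue_rV R d1) Omega1 delta m M (U \_ Omega1) ->
    admissible (lebesgue_rV R d2) Omega2 delta m M (V \_ Omega2) ->
    minimizer (lebesgue_rV R d1) (lebesgue_rV R d2) Omega1 Omega2 gamma
      (c \_ (Omega1 `*` Omega2)) (U \_ Omega1) (V \_ Omega2)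
      (solution_op Omega1 Omega2 gamma c U V \_ (Omega1 `*` Omega2)).
  move=> cL aU aV; have sU := adm_sqint aU; have sV := adm_sqint aV.
  apply/is_optimalP => //; apply: getPex.
  have /L2P sc := cL.
  have [s [ps smin]] := exists_minimizer mO1 mO2 O1_fin O2_fin gamma_gt0 sc sU sV
    (ex_intro _ _ (plan_admissible mO1 mO2 O1_fin O2_fin delta_gt0 m_gt0 aU aV)).
  have [_ supps _ _ _] := ps.
  by exists s; apply/is_optimalP => //; rewrite (patch_supported supps).
have solmu := solutionP _ _ _ cmuL amu1 amu2.
have solnu := solutionP _ _ _ cnuL anu1 anu2.
have [[smu _ _ _ _] _] := solmu; have [[snu _ _ _ _] _] := solnu.
rewrite normL2E; last by apply/L2P; rewrite patch_subr; exact: sqintB.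
rewrite poweR_EFin -EFinM lee_fin powR12_sqrt ?sqrtr_ge0// !patch_subr.
have [hc h1 h2] := ler_sqrt_sum3
  (nrm_ge0 (lebesgue_rV R d1 \x lebesgue_rV R d2)%E
    ((cmu \_ (Omega1 `*` Omega2)) \- (cnu \_ (Omega1 `*` Omega2))))
  (nrm_ge0 (lebesgue_rV R d1) ((mu1 \_ Omega1) \- (nu1 \_ Omega1)))
  (nrm_ge0 (lebesgue_rV R d2) ((mu2 \_ Omega2) \- (nu2 \_ Omega2))).
have /L2P scmu := cmuL; have /L2P scnu := cnuL.
(* Here [h] is the distance of the data in the product norm, which dominates each of the three
   component distances. *)
apply: (Lip _ (cmu \_ (Omega1 `*` Omega2)) (cnu \_ (Omega1 `*` Omega2))
  _ _ _ _ _ _ (sqrtr_ge0 _) scmu _ scnu _ _ _ amu1 amu2 anu1 anu2 solmu solnu) => //.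
- exact: le_trans muM.
- exact: le_trans nuM.
- exact: ae_ge_patch.
- exact: ae_ge_patch.
Qed.
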